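(* Let $A$ be a normal noetherian domain. Then the affine class groups of $A$ and of the polynomial ring $A[T]$ coincide: $ACl\, A = ACl\, A[T]$.
   Context: A normal scheme means a noetherian separated irreducible reduced normal scheme. A divisor is a Weil divisor; it is called trivial if it is principal. The complement of an effective divisor is the complement of its support. Let $X$ be a normal scheme. A divisor $D$ on $X$ is coaffine if for every effective divisor $E$ linearly equivalent to $D$ the complement of $E$ is an affine scheme. $D$ is strongly coaffine if for every $n\in\mathbb{Z}$ the divisor $nD$ is coaffine or trivial. $D$ is affine trivial if for every strongly coaffine divisor $E$ the divisor $D+E$ is again strongly coaffine. The affine trivial divisors form a subgroup of $\operatorname{Div} X$ containing the principal divisors; the affine class group $ACl\, X$ is the group of divisors modulo the affine trivial divisors (a quotient of the divisor class group $Cl\, X$). For a normal noetherian domain $A$ put $ACl\, A = ACl(\operatorname{Spec} A)$. The equality of affine class groups means that the pull-back of divisors along $A\to A[T]$ induces an isomorphism. *)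

(* Defs.v *)
From HB Require Import structures.
From mathcomp Require Import all_boot all_order all_algebra.
From mathcomp Require Import generic_quotient ring_quotient fraction mxpoly.
From mathcomp Require Import all_classical topology_structure subtype_topology.
From mathcomp Require Import ring.
From mathcomp Require Import freeg.

Set Implicit Arguments.
Unset Strict Implicit.
Unset Printing Implicit Defensive.

Import GRing.Theory Num.Theory.
Local Open Scope classical_set_scope.
Local Open Scope ring_scope.
Local Open Scope quotient_scope.

Definition is_ideal (R : comPzRingType) (I : set R) : Prop :=
  I 0 /\ forall a x y, I x -> I y -> I (a * x + y).

Definition is_prime (R : comPzRingType) (P : set R) : Prop :=
  [/\ is_ideal P, ~ P 1 & forall x y, P (x * y) -> P x \/ P y].

Record Spec (R : comPzRingType) := MkSpec {
  spec_set :> set R;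
  spec_prime : is_prime spec_set }.

HB.instance Definition _ (R : comPzRingType) := gen_eqMixin (Spec R).
HB.instance Definition _ (R : comPzRingType) := gen_choiceMixin (Spec R).

Section Zariski.
Variable R : comPzRingType.

Definition zariski_open : set_system (Spec R) :=
  [set U | exists S : set R, U = [set p : Spec R | ~ (S `<=` p)]].

Lemma zariski_openT : zariski_open setT.
Proof.
exists setT; apply/seteqP; split=> // p _ /(_ 1 I).
by case: (spec_prime p).
Qed.

Lemma zariski_openI : setI_closed zariski_open.
Proof.
move=> _ _ [S ->] [T ->]; exists [set z | exists x y, [/\ S x, T y & z = x * y]].
apply/seteqP; split=> p /=.
  move=> [/existsNP[x /not_implyP[Sx px]] /existsNP[y /not_implyP[Ty py]]] sub.
  have [_ _ pP] := spec_prime p.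
  by have /pP[] : spec_set p (x * y) by apply: sub; exists x, y.
have [[p0 pD] _ _] := spec_prime p.
move=> nsub; split=> sub; apply: nsub => _ [x [y [Sx Ty ->]]].
  by rewrite mulrC -[_ * _]addr0; apply: pD => //; exact: sub.
by rewrite -[_ * _]addr0; apply: pD => //; exact: sub.
Qed.

Lemma zariski_open_bigU (J : Type) (F : J -> set (Spec R)) :
  (forall j, zariski_open (F j)) -> zariski_open (\bigcup_j F j).
Proof.
move=> /choice[S FS]; exists (\bigcup_j S j).
apply/seteqP; split=> p /=.
  by move=> [j _]; rewrite FS => nsub sub; apply: nsub => x Sx; apply: sub; exists j.
move=> /existsNP[x /not_implyP[[j _ Sx] px]]; exists j => //.
by rewrite FS => /(_ x Sx).
Qed.

HB.instance Definition _ := isOpenTopological.Build (Spec R)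
  zariski_openT zariski_openI zariski_open_bigU.

End Zariski.

Record prefrac (R : comPzRingType) (p : Spec R) := PreFrac {
  pf_num : R;
  pf_den : R;
  pf_denP : ~ spec_set p pf_den }.

HB.instance Definition _ (R : comPzRingType) (p : Spec R) :=
  gen_eqMixin (prefrac p).
HB.instance Definition _ (R : comPzRingType) (p : Spec R) :=
  gen_choiceMixin (prefrac p).

Section Localization.
Variables (R : comPzRingType) (p : Spec R).
Implicit Types x y z : prefrac p.

Definition prefrac_equiv x y : bool :=
  `[< exists2 u : R, ~ spec_set p u & u * (pf_num x * pf_den y) = u * (pf_num y * pf_den x) >].

Lemma spec_nmem1 : ~ spec_set p 1. Proof. by case: (spec_prime p). Qed.

Lemma spec_nmemM (a b : R) : ~ spec_set p a -> ~ spec_set p b -> ~ spec_set p (a * b).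
Proof. by have [_ _ pP] := spec_prime p => pa pb /pP[]. Qed.

Lemma prefrac_equiv_refl : reflexive prefrac_equiv.
Proof. by move=> x; apply/asboolP; exists 1 => //; exact: spec_nmem1. Qed.

Lemma prefrac_equiv_sym : symmetric prefrac_equiv.
Proof.
by move=> x y; apply/asboolP/asboolP => -[u pu e]; exists u.
Qed.

Lemma prefrac_equiv_trans : transitive prefrac_equiv.
Proof.
move=> y x z /asboolP[u pu e] /asboolP[v pv f]; apply/asboolP.
exists (u * v * pf_den y).
  by apply: spec_nmemM; [exact: spec_nmemM | exact: pf_denP].
have -> : u * v * pf_den y * (pf_num x * pf_den z) =
  u * (pf_num x * pf_den y) * (v * pf_den z) by ring.
rewrite e.
have -> : u * (pf_num y * pf_den x) * (v * pf_den z) =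
  v * (pf_num y * pf_den z) * (u * pf_den x) by ring.
rewrite f; ring.
Qed.

Canonical prefrac_equiv_rel := EquivRel prefrac_equiv
  prefrac_equiv_refl prefrac_equiv_sym prefrac_equiv_trans.

Definition loc := {eq_quot prefrac_equiv}.

HB.instance Definition _ : EqQuotient _ prefrac_equiv loc := EqQuotient.on loc.
HB.instance Definition _ := Choice.on loc.

Definition mkloc (a s : R) (ps : ~ spec_set p s) : loc := \pi_loc (PreFrac a ps).

Lemma mkloc_eqP (a s b t : R) (ps : ~ spec_set p s) (pt : ~ spec_set p t) :
  mkloc a ps = mkloc b pt <-> exists2 u : R, ~ spec_set p u & u * (a * t) = u * (b * s).
Proof.
rewrite /mkloc; split=> [/eqmodP/asboolP //|e].
by apply/eqmodP/asboolP.
Qed.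

Lemma locW (x : loc) : exists a s (ps : ~ spec_set p s), x = mkloc a ps.
Proof.
rewrite -[x]reprK; case: (repr x) => a s ps; by exists a, s, ps.
Qed.

Definition loc_num (x : loc) : R := pf_num (repr x).
Definition loc_den (x : loc) : R := pf_den (repr x).
Lemma loc_denP (x : loc) : ~ spec_set p (loc_den x). Proof. exact: pf_denP. Qed.

Lemma loc_numden (x : loc) : mkloc (loc_num x) (loc_denP (x := x)) = x.
Proof.
rewrite -[RHS]reprK /mkloc /loc_num; congr (\pi_loc _).
move: (loc_denP (x := x)); rewrite /loc_den.
by case: (repr x) => a s ps /= ps'; congr PreFrac; exact: Prop_irrelevance.
Qed.

Definition loc_zero : loc := mkloc 0 spec_nmem1.
Definition loc_one : loc := mkloc 1 spec_nmem1.
Definition loc_opp (x : loc) : loc := mkloc (- loc_num x) (loc_denP (x := x)).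
Definition loc_add (x y : loc) : loc :=
  mkloc (loc_num x * loc_den y + loc_num y * loc_den x)
    (spec_nmemM (loc_denP (x := x)) (loc_denP (x := y))).
Definition loc_mul (x y : loc) : loc :=
  mkloc (loc_num x * loc_num y)
    (spec_nmemM (loc_denP (x := x)) (loc_denP (x := y))).

Lemma loc_repr (a s : R) (ps : ~ spec_set p s) :
  exists2 u : R, ~ spec_set p u &
    u * (loc_num (mkloc a ps) * s) = u * (a * loc_den (mkloc a ps)).
Proof. exact/(mkloc_eqP _ _ (loc_denP (x := _)) ps)/loc_numden. Qed.

Lemma loc_oppE (a s : R) (ps : ~ spec_set p s) : loc_opp (mkloc a ps) = mkloc (- a) ps.
Proof.
have [u pu e] := loc_repr a ps.
by apply/mkloc_eqP; exists u => //; rewrite !mulNr !mulrN e.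
Qed.

Lemma loc_addE (a s b t : R) (ps : ~ spec_set p s) (pt : ~ spec_set p t) :
  loc_add (mkloc a ps) (mkloc b pt) = mkloc (a * t + b * s) (spec_nmemM ps pt).
Proof.
have [u pu e] := loc_repr a ps; have [v pv f] := loc_repr b pt.
apply/mkloc_eqP; exists (u * v); first exact: spec_nmemM.
set c := loc_num _ in e *; set d := loc_den _ in e *.
set c' := loc_num _ in f *; set d' := loc_den _ in f *.
have -> : u * v * ((c * d' + c' * d) * (s * t)) =
  u * (c * s) * (v * d' * t) + v * (c' * t) * (u * d * s) by ring.
rewrite e f; ring.
Qed.

Lemma loc_mulE (a s b t : R) (ps : ~ spec_set p s) (pt : ~ spec_set p t) :
  loc_mul (mkloc a ps) (mkloc b pt) = mkloc (a * b) (spec_nmemM ps pt).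
Proof.
have [u pu e] := loc_repr a ps; have [v pv f] := loc_repr b pt.
apply/mkloc_eqP; exists (u * v); first exact: spec_nmemM.
set c := loc_num _ in e *; set d := loc_den _ in e *.
set c' := loc_num _ in f *; set d' := loc_den _ in f *.
have -> : u * v * (c * c' * (s * t)) = u * (c * s) * (v * (c' * t)) by ring.
rewrite e f; ring.
Qed.

Lemma mkloc_eq (a s b t : R) (ps : ~ spec_set p s) (pt : ~ spec_set p t) :
  a * t = b * s -> mkloc a ps = mkloc b pt.
Proof. by move=> e; apply/mkloc_eqP; exists 1; [exact: spec_nmem1 | rewrite e]. Qed.

Lemma loc_addA : associative loc_add.
Proof.
move=> x y z; have [a [s [ps ->]]] := locW x.
have [b [t [pt ->]]] := locW y; have [c [r [pr ->]]] := locW z.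
by rewrite !loc_addE; apply: mkloc_eq; ring.
Qed.

Lemma loc_addC : commutative loc_add.
Proof.
move=> x y; have [a [s [ps ->]]] := locW x; have [b [t [pt ->]]] := locW y.
by rewrite !loc_addE; apply: mkloc_eq; ring.
Qed.

Lemma loc_add0 : left_id loc_zero loc_add.
Proof.
by move=> x; have [a [s [ps ->]]] := locW x; rewrite loc_addE; apply: mkloc_eq; ring.
Qed.

Lemma loc_addN : left_inverse loc_zero loc_opp loc_add.
Proof.
move=> x; have [a [s [ps ->]]] := locW x.
by rewrite loc_oppE loc_addE; apply: mkloc_eq; ring.
Qed.

Lemma loc_mulA : associative loc_mul.
Proof.
move=> x y z; have [a [s [ps ->]]] := locW x.
have [b [t [pt ->]]] := locW y; have [c [r [pr ->]]] := locW z.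
by rewrite !loc_mulE; apply: mkloc_eq; ring.
Qed.

Lemma loc_mulC : commutative loc_mul.
Proof.
move=> x y; have [a [s [ps ->]]] := locW x; have [b [t [pt ->]]] := locW y.
by rewrite !loc_mulE; apply: mkloc_eq; ring.
Qed.

Lemma loc_mul1 : left_id loc_one loc_mul.
Proof.
by move=> x; have [a [s [ps ->]]] := locW x; rewrite loc_mulE; apply: mkloc_eq; ring.
Qed.

Lemma loc_mulDl : left_distributive loc_mul loc_add.
Proof.
move=> x y z; have [a [s [ps ->]]] := locW x.
have [b [t [pt ->]]] := locW y; have [c [r [pr ->]]] := locW z.
by rewrite !(loc_addE, loc_mulE); apply: mkloc_eq; ring.
Qed.

HB.instance Definition _ :=
  GRing.isZmodule.Build loc loc_addA loc_addC loc_add0 loc_addN.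
HB.instance Definition _ :=
  GRing.Zmodule_isComPzRing.Build loc loc_mulA loc_mulC loc_mul1 loc_mulDl.

End Localization.

Definition dprod (T : Type) (F : T -> comPzRingType) := forall x, F x.

Section DependentProduct.
Variables (T : Type) (F : T -> comPzRingType).
Implicit Types f g h : dprod F.

HB.instance Definition _ := gen_eqMixin (dprod F).
HB.instance Definition _ := gen_choiceMixin (dprod F).

Let dadd f g : dprod F := fun x => f x + g x.
Let dopp f : dprod F := fun x => - f x.
Let dmul f g : dprod F := fun x => f x * g x.

Let daddA : associative dadd.
Proof. by move=> f g h; apply: functional_extensionality_dep => x; exact: addrA. Qed.
Let daddC : commutative dadd.
Proof. by move=> f g; apply: functional_extensionality_dep => x; exact: addrC. Qed.
Let dadd0 : left_id (fun=> 0) dadd.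
Proof. by move=> f; apply: functional_extensionality_dep => x; exact: add0r. Qed.
Let daddN : left_inverse (fun=> 0) dopp dadd.
Proof. by move=> f; apply: functional_extensionality_dep => x; exact: addNr. Qed.
Let dmulA : associative dmul.
Proof. by move=> f g h; apply: functional_extensionality_dep => x; exact: mulrA. Qed.
Let dmulC : commutative dmul.
Proof. by move=> f g; apply: functional_extensionality_dep => x; exact: mulrC. Qed.
Let dmul1 : left_id (fun=> 1) dmul.
Proof. by move=> f; apply: functional_extensionality_dep => x; exact: mul1r. Qed.
Let dmulDl : left_distributive dmul dadd.
Proof. by move=> f g h; apply: functional_extensionality_dep => x; exact: mulrDl. Qed.

HB.instance Definition _ :=
  GRing.isZmodule.Build (dprod F) daddA daddC dadd0 daddN.
HB.instance Definition _ :=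
  GRing.Zmodule_isComPzRing.Build (dprod F) dmulA dmulC dmul1 dmulDl.

End DependentProduct.

Section StructureSheaf.
Variables (R : comPzRingType) (V : set (Spec R)).

Definition germs : comPzRingType := dprod (fun p : V => loc (set_val p)).

Definition locally_fraction (s : germs) : Prop :=
  forall p : V, exists W : set (Spec R), [/\ open W, W (set_val p) &
    exists a f : R, forall q : V, W (set_val q) ->
      exists qf : ~ spec_set (set_val q) f, s q = mkloc a qf].

Definition regular : pred germs := fun s => `[< locally_fraction s >].

Lemma regular_subring : subring_closed regular.
Proof.
split=> [|s t /asboolP sP /asboolP tP|s t /asboolP sP /asboolP tP]; apply/asboolP.
- move=> p; exists setT; split=> //; first exact: openT.
  by exists 1, 1 => q _; exists (spec_nmem1 (p := set_val q)).
- move=> p; have [W [oW Wp [a [f sE]]]] := sP p.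
  have [W' [oW' Wp' [b [g tE]]]] := tP p.
  exists (W `&` W'); split=> //; first exact: openI.
  exists (a * g + (- b) * f), (f * g) => q [/sE[qf e] /tE[qg e']].
  exists (spec_nmemM qf qg).
  by rewrite -loc_addE -loc_oppE -e -e'.
- move=> p; have [W [oW Wp [a [f sE]]]] := sP p.
  have [W' [oW' Wp' [b [g tE]]]] := tP p.
  exists (W `&` W'); split=> //; first exact: openI.
  exists (a * b), (f * g) => q [/sE[qf e] /tE[qg e']].
  exists (spec_nmemM qf qg).
  by rewrite -loc_mulE -e -e'.
Qed.

(** The ring [O(V)] of sections of the structure sheaf over an open set [V]. *)
Record sections := MkSections {
  section_fun :> germs;
  sectionP : section_fun \in regular }.

HB.instance Definition _ := [isSub for section_fun].
HB.instance Definition _ := [Choice of sections by <:].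
HB.instance Definition _ := 
  GRing.SubChoice_isSubComPzRing.Build germs regular sections regular_subring.

End StructureSheaf.

Section Restriction.
Variables (R : comPzRingType) (V W : set (Spec R)) (VW : V `<=` W).

Definition widen (p : V) : W := exist _ (set_val p) (mem_set (VW (set_valP p))).

Lemma restrict_regular (s : sections W) :
  ((fun p : V => section_fun s (widen p)) : germs V) \in regular (V := V).
Proof.
have /asboolP sP := sectionP s; apply/asboolP => p.
have [Z [oZ Zp [a [f sE]]]] := sP (widen p).
by exists Z; split=> //; exists a, f => q Zq; exact: (sE (widen q)).
Qed.

Definition restrict (s : sections W) : sections V :=
  MkSections (restrict_regular s).

End Restriction.

Lemma image_preimage_subset (T S : Type) (U : set T) (h : U -> S) (V W : set S) :
  V `<=` W -> set_val @` (h @^-1` V) `<=` set_val @` (h @^-1` W).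
Proof. by move=> VW _ [x Vx <-]; exists x => //; exact: VW. Qed.

(** The open subscheme [U] of [Spec R] is affine: as a ringed space it is
    isomorphic to [Spec B] for some ring [B].  Between locally ringed spaces,
    an isomorphism of ringed spaces is automatically local on the stalks. *)
Definition affine_open (R : comPzRingType) (U : set (Spec R)) : Prop :=
  exists (B : comPzRingType) (h : U -> Spec B) (g : Spec B -> U)
    (phi : forall V : set (Spec B), open V ->
      {rmorphism sections V -> sections (set_val @` (h @^-1` V))}),
    [/\ continuous h, continuous g, cancel h g, cancel g h &
        (forall V (oV : open V), bijective (phi V oV)) /\
        (forall V W (oV : open V) (oW : open W) (VW : V `<=` W) (s : sections W),
          phi V oV (restrict VW s) =
          restrict (image_preimage_subset (h := h) VW) (phi W oW s))].

Definition noetherian (A : comPzRingType) : Prop :=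
  forall I : set A, is_ideal I -> exists (n : nat) (g : 'I_n -> A),
    I = [set x | exists c : 'I_n -> A, x = \sum_i c i * g i].

Definition normal_domain (A : idomainType) : Prop :=
  forall x : {fraction A}, integralOver (@tofrac A) x -> exists a : A, x = tofrac a.

Definition height_one (A : idomainType) (p : Spec A) : Prop :=
  (exists2 x, spec_set p x & x != 0) /\
  forall q : Spec A, q `<=` p -> q `<=` [set 0] \/ p `<=` q.

Record primeDivisor (A : idomainType) := MkPrimeDivisor {
  pd_point :> Spec A;
  pd_height : height_one pd_point }.

HB.instance Definition _ (A : idomainType) := gen_eqMixin (primeDivisor A).
HB.instance Definition _ (A : idomainType) := gen_choiceMixin (primeDivisor A).

Notation Div A := {freeg (primeDivisor A) / int}.

Section Divisors.
Variable A : idomainType.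
Implicit Types (p : primeDivisor A) (D E : Div A).

Definition loc_unit (p : Spec A) (x : loc p) : Prop := exists y, x * y = 1.

Definition uniformizer (p : Spec A) (t : loc p) : Prop :=
  forall x : loc p, ~ loc_unit x <-> exists y, x = t * y.

(** The normalized valuation of the discrete valuation ring [loc p] (it is one
    when [A] is noetherian and normal), as a functional relation, first on
    nonzero elements of [A], then on nonzero elements of the function field. *)
Definition has_order_int p (a : A) (n : nat) : Prop :=
  exists t u : loc p, [/\ uniformizer t, loc_unit u &
    mkloc a (spec_nmem1 (p := p)) = u * t ^+ n].

Definition has_order p (f : {fraction A}) (n : int) : Prop :=
  exists (a b : A) (k l : nat), [/\ b != 0, f = tofrac a / tofrac b,
    has_order_int p a k, has_order_int p b l & n = k%:Z - l%:Z].

Definition principal D : Prop :=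
  exists2 f : {fraction A}, f != 0 & forall p, has_order p f (coeff p D).

Definition lin_equiv D E : Prop := principal (D - E).

Definition effective D : Prop := forall p, 0 <= coeff p D.

(** The complement of the support of [D]; a point [q] lies on the prime divisor
    with generic point [p] iff [p] is contained in [q]. *)
Definition complement D : set (Spec A) :=
  [set q | forall p, coeff p D != 0 -> ~ (p `<=` q)].

Definition coaffine D : Prop :=
  forall E, effective E -> lin_equiv E D -> affine_open (complement E).

Definition strongly_coaffine D : Prop :=
  forall n : int, coaffine (D *~ n) \/ principal (D *~ n).

Definition affine_trivial : {pred Div A} := fun D =>
  `[< forall E, strongly_coaffine E -> strongly_coaffine (D + E) >].

Lemma strongly_coaffineN D : strongly_coaffine D -> strongly_coaffine (- D).
Proof. by move=> sD n; rewrite mulNrz -mulrNz; exact: sD. Qed.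

Lemma affine_trivial_zmod : zmod_closed affine_trivial.
Proof.
split=> [|D D' /asboolP tD /asboolP tD'].
  by apply/asboolP => E; rewrite add0r.
apply/asboolP => E sE; rewrite -addrA; apply: tD.
rewrite -[- D' + E]opprK opprD opprK; apply: strongly_coaffineN.
exact/tD'/strongly_coaffineN.
Qed.

HB.instance Definition _ :=
  GRing.isZmodClosed.Build (Div A) affine_trivial affine_trivial_zmod.

(** [Quotient.quot I] is the quotient of an additive group by a subgroup [I]; it
    is displayed with the notation for quotients by ideals. *)
Definition affine_class_group := Quotient.quot affine_trivial.

Definition affine_class D : affine_class_group := \pi_affine_class_group D.

End Divisors.

(** The extension of the ideal [p] to [A[T]] consists of the polynomials with
    all coefficients in [p]. *)
Definition poly_extension (A : idomainType) (p : set A) : set {poly A} :=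
  [set f | forall i, p f`_i].

(** The inverse image of the integral closed subscheme [V(p)] is the integral
    closed subscheme [V(pA[T])], so the pull-back of the prime divisor [p] is the
    prime divisor [pA[T]] with multiplicity one.  If [A] is noetherian, then
    [pA[T]] has height one and the default value [0] is never used. *)
Definition pullback_prime (A : idomainType) (p : primeDivisor A) :
    Div {poly A} :=
  match pselect (exists P : primeDivisor {poly A},
    spec_set P = poly_extension p) with
  | left e => << projT1 (cid e) >>
  | right _ => 0
  end.

Definition pullback (A : idomainType) (D : Div A) : Div {poly A} :=
  \sum_(p <- dom D) pullback_prime p *~ coeff p D.

(* Main.v *)
From HB Require Import structures.
Require Import Defs.
From mathcomp Require Import all_boot all_order all_algebra.
From mathcomp Require Import generic_quotient ring_quotient fraction mxpoly.
From mathcomp Require Import all_classical topology_structure subtype_topology.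
From mathcomp Require Import ring zify.
From mathcomp Require Import freeg.

(** A Weil divisor [E] on a normal noetherian domain has an affine complement [U]
    iff the equations of [E] generate the unit ideal of the ring of regular
    functions on [U], and both the equations and the regular functions are
    described by the valuations of the prime divisors.

    Every divisor of [A[T]] is linearly equivalent to a pull-back, so it is enough
    to see that [D] is coaffine iff its pull-back is.  If the pull-back is coaffine
    and [E ~ D] is effective, then the constant coefficients of a relation for the
    complement of the pull-back of [E] give a relation for the complement of [E].
    Conversely, let [F ~ pullback D] be effective.  Up to a divisor of an element of
    [A] it is [pullback D + div g] with [g = sum g_i T^i], and the effective divisors
    [E_i = D + div g_i ~ D] have affine complements.  The functions [g_i / g] are
    regular on the complement of [F], they vanish there exactly over [E_i], and
    [sum (g_i / g) T^i = 1]; so they generate the unit ideal, while each of them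
    lies in the radical of the ideal generated by the equations of [F]. *)

Set Implicit Arguments.
Unset Strict Implicit.
Unset Printing Implicit Defensive.

Import Order.TTheory GRing.Theory Num.Theory.
Local Open Scope classical_set_scope.
Local Open Scope ring_scope.
Local Open Scope quotient_scope.

(** * Ideals *)

(** Both hypotheses are carried to [A[T]]: [noetherian] by the basis theorem, and normality as
    complete integral closedness, whose passage to polynomials is a computation with powers and
    leading coefficients. From these two properties come, for [A] and [A[T]] alike, a uniformizer at
    each prime of height one and the equality of each localization with the intersection of the
    valuation rings containing it. The obstacle on the way from [A] to [A[T]] is an effective [F]
    with horizontal components, which is not a pull-back. The coefficients of [g] lead back to [A]:
    the order of [g] along [pA[T]] is the minimum of the orders of the [g_i], so effectivity of [F]
    passes to every [E_i]. Since the divisor of [g_i / g] is [pullback E_i - F], comparing it with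
    equations of [E_i] and [F] involves multiplicities and hence powers, so only the radical is
    reached; this suffices, as 1 lies in the radical only if it lies in the ideal. In the other
    direction, a function regular off a pull-back has poles along vertical divisors only, so one
    constant [d] clears the denominators before constant coefficients are taken. *)

Section Ideals.
Variable R : comPzRingType.
Implicit Types (I J : set R).

Lemma ideal0 I : is_ideal I -> I 0. Proof. by case. Qed.
Lemma ideal_mull I a x : is_ideal I -> I x -> I (a * x).
Proof. by move=> [I0 IM] Ix; rewrite -[_ * _]addr0; exact: IM. Qed.
Lemma ideal_mulr I a x : is_ideal I -> I x -> I (x * a).
Proof. by rewrite mulrC; exact: ideal_mull. Qed.
Lemma idealD I x y : is_ideal I -> I x -> I y -> I (x + y).
Proof. by move=> [_ IM] Ix Iy; rewrite -[x]mul1r; exact: IM. Qed.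
Lemma idealN I x : is_ideal I -> I x -> I (- x).
Proof. by rewrite -mulN1r; exact: ideal_mull. Qed.
Lemma idealB I x y : is_ideal I -> I x -> I y -> I (x - y).
Proof. by move=> iI Ix Iy; apply: idealD => //; exact: idealN. Qed.
Lemma ideal_sum I (T : Type) (s : seq T) (P : pred T) (F : T -> R) :
  is_ideal I -> (forall i, P i -> I (F i)) -> I (\sum_(i <- s | P i) F i).
Proof.
move=> iI IF; elim/big_ind : _ => //; first exact: ideal0.
by move=> x y; exact: idealD.
Qed.

Definition ideal_adjoin I x : set R := [set z | exists a b, I a /\ z = a + b * x].

Lemma ideal_adjoinP I x : is_ideal I -> is_ideal (ideal_adjoin I x).
Proof.
move=> iI; split; first by exists 0, 0; rewrite mul0r addr0; split=> //; exact: ideal0.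
move=> c _ _ [a [b [Ia ->]]] [a' [b' [Ia' ->]]].
exists (c * a + a'), (c * b + b'); split; last by ring.
by apply: idealD => //; exact: ideal_mull.
Qed.

Lemma ideal_adjoin_sub I x : I `<=` ideal_adjoin I x.
Proof. by move=> a Ia; exists a, 0; rewrite mul0r addr0. Qed.

Lemma ideal_adjoin_mem I x : is_ideal I -> ideal_adjoin I x x.
Proof. by move=> iI; exists 0, 1; rewrite mul1r add0r; split=> //; exact: ideal0. Qed.

Lemma chain_ideal (F : set (set R)) :
  F !=set0 -> (forall I, F I -> is_ideal I) -> total_on F subset ->
  is_ideal (\bigcup_(I in F) I).
Proof.
move=> [I0 FI0] Fid tot; split; first by exists I0 => //; case: (Fid _ FI0).
move=> a x y [I FI Ix] [J FJ Jy]; case: (tot _ _ FI FJ) => IJ.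
  by exists J => //; apply: (Fid _ FJ).2 => //; exact: IJ.
by exists I => //; apply: (Fid _ FI).2 => //; exact: IJ.
Qed.

Lemma zorn_ideal (Q : set (set R)) : Q !=set0 -> (forall I, Q I -> is_ideal I) ->
  (forall F : set (set R), F !=set0 -> F `<=` Q -> total_on F subset ->
     Q (\bigcup_(I in F) I)) ->
  exists2 M, Q M & forall I, Q I -> M `<=` I -> I = M.
Proof.
move=> [I0 QI0] Qid Qchain.
have Qn0 I : Q I -> I !=set0 by move=> /Qid[I1 _]; exists 0.
have [|M [QM maxM]] := @Zorn_bigcup R [set I | I = set0 \/ Q I].
  move=> F FQ tot; have [[I [FI In0]]|/forallNP Fn] := pselect (exists I, F I /\ I !=set0).
    have -> : \bigcup_(I in F) I = \bigcup_(I in [set I | F I /\ I !=set0]) I.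
      apply/seteqP; split=> x [J] /=; last by move=> [FJ _ Jx]; exists J.
      by move=> FJ Jx; exists J => //; split=> //; exists x.
    right; apply: Qchain; first by exists I.
      move=> J [FJ [x Jx]]; case: (FQ _ FJ) => // J0; by rewrite J0 in Jx.
    by move=> J K [FJ _] [FK _]; exact: tot.
  left; apply/seteqP; split=> [x [J FJ Jx]|x []] /=.
  by apply: (Fn J); split=> //; exists x.
have MQ : Q M.
  case: QM => // M0; exfalso; apply: (maxM I0); last by right.
  rewrite M0; split=> // /(_ 0) h.
  by apply: h; case: (Qid _ QI0).
exists M => // I QI MI; apply/seteqP; split=> //.
apply: contrapT => nIM; apply: (maxM I); last by right.
by split.
Qed.

Lemma exists_prime I : is_ideal I -> ~ I 1 -> exists p : Spec R, I `<=` p.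
Proof.
move=> iI I1.
have [||F Fn0 FQ tot|M [idM M1 IM] maxM] :=
  @zorn_ideal [set J | [/\ is_ideal J, ~ J 1 & I `<=` J]].
- by exists I; split.
- by move=> J [].
- split; first by apply: chain_ideal => // J /FQ[].
    by move=> [J /FQ[_ J1 _]].
  by case: Fn0 => J FJ x Ix; exists J => //; have [_ _] := FQ _ FJ; exact.
have adj x : ~ M x -> ideal_adjoin M x 1.
  move=> Mx; apply: contrapT => n1; apply: Mx.
  rewrite -(maxM (ideal_adjoin M x)); first exact: ideal_adjoin_mem.
    split=> //; first exact: ideal_adjoinP.
    exact: (subset_trans IM (@ideal_adjoin_sub _ _)).
  exact: ideal_adjoin_sub.
suff pM : is_prime M by exists (MkSpec pM).
split=> // x y Mxy; apply: contrapT => /not_orP[/adj[a [b [Ma ab]]] /adj[c [d [Mc cd]]]].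
apply: M1; rewrite -[1]mulr1 {1}ab cd.
have -> : (a + b * x) * (c + d * y) = (c + d * y) * a + (b * x * c + b * d * (x * y)) by ring.
apply: idealD => //; first exact: ideal_mull.
by apply: idealD => //; exact: ideal_mull.
Qed.

Hypothesis hN : noetherian R.

(** The ascending chain condition in the form of maximal members: the union of a chain is an ideal,
    its finitely many generators lie in one member, and so the union is that member. *)
Lemma acc (Q : set (set R)) : Q !=set0 -> (forall I, Q I -> is_ideal I) ->
  exists2 M, Q M & forall I, Q I -> M `<=` I -> I = M.
Proof.
move=> Qn0 Qid; apply: zorn_ideal => // F Fn0 FQ tot.
have iU : is_ideal (\bigcup_(I in F) I) by apply: chain_ideal => // I /FQ /Qid.
have [n [g E]] := hN iU.
have gU i : (\bigcup_(I in F) I) (g i).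
  rewrite E; exists (fun j => (j == i)%:R).
  rewrite (bigD1 i) //= eqxx mul1r big1 ?addr0 // => j /negPf ->; by rewrite mul0r.
have [J FJ gJ] : exists2 J, F J & forall i, J (g i).
  clear E; elim: n g gU => [|n IH] g gU; first by case: Fn0 => J FJ; exists J => // -[].
  have [J FJ gJ] := IH (fun i => g (fintype.lift ord0 i)) (fun i => gU _).
  have [K FK gK] := gU ord0.
  have [JK|KJ] := tot _ _ FJ FK.
    exists K => // i; have [j ->|->//] := unliftP ord0 i; exact/JK/gJ.
  by exists J => // i; have [j ->|->] := unliftP ord0 i; [exact: gJ | exact: KJ].
suff -> : \bigcup_(I in F) I = J by exact: FQ.
apply/seteqP; split; last by move=> x Jx; exists J.
rewrite E => _ [c ->]; apply: ideal_sum => [|i _]; first exact/Qid/FQ.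
by apply: ideal_mull => //; exact/Qid/FQ.
Qed.

Lemma noetherian_ind (Q : set R -> Prop) :
  (forall I, is_ideal I -> (forall J, is_ideal J -> I `<=` J -> I <> J -> Q J) -> Q I) ->
  forall I, is_ideal I -> Q I.
Proof.
move=> H I iI; apply: contrapT => nQ.
have [||M [iM nQM] maxM] := @acc [set J | is_ideal J /\ ~ Q J]; first by exists I.
  by move=> J [].
apply: nQM; apply: H => // J iJ MJ ne; apply: contrapT => nQJ.
by apply: ne; rewrite (maxM J).
Qed.

(** Noetherian induction: if [x * y] lies in [I] but neither factor does, a prime over [I] contains
    one of the strictly larger ideals [I + (x)] and [I + (y)]. This will make the support of the
    divisor of a function finite. *)
Lemma finite_primes I : is_ideal I -> exists s : seq (Spec R),
  forall p : Spec R, I `<=` p -> exists2 q, q \in s & I `<=` q /\ q `<=` p.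
Proof.
move: I; apply: noetherian_ind => I iI IH.
have [I1|I1] := pselect (I 1).
  exists [::] => p Ip; have [_ p1 _] := spec_prime p; by case: p1; apply: Ip.
have [pI|nP] := pselect (is_prime I).
  by exists [:: MkSpec pI] => p Ip; exists (MkSpec pI); rewrite ?inE //; split.
have [x [y [Ixy Ix Iy]]] : exists x y, [/\ I (x * y), ~ I x & ~ I y].
  apply: contrapT => nE; apply: nP.
  split=> // x y Ixy; apply: contrapT => /not_orP[Ix Iy].
  by apply: nE; exists x, y.
have step z : ~ I z -> exists s : seq (Spec R),
    forall p : Spec R, ideal_adjoin I z `<=` p -> exists2 q, q \in s & I `<=` q /\ q `<=` p.
  move=> Iz; have [||e|s sP] := IH (ideal_adjoin I z).
  - exact: ideal_adjoinP.
  - exact: ideal_adjoin_sub.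
  - by apply: Iz; rewrite e; exact: ideal_adjoin_mem.
  - exists s => p /sP[q qs [Iq qp]]; exists q => //; split=> //.
    exact: (subset_trans (@ideal_adjoin_sub _ _) Iq).
have [s sP] := step _ Ix; have [t tP] := step _ Iy.
exists (s ++ t) => p Ip; have [ip _ pP] := spec_prime p.
have sub z : spec_set p z -> ideal_adjoin I z `<=` p.
  move=> pz _ [a [b [Ia ->]]]; apply: idealD => //; first exact: Ip.
  exact: ideal_mull.
have [/sub/sP|/sub/tP] := pP _ _ (Ip _ Ixy); move=> [q qs h]; exists q => //;
  by rewrite mem_cat qs ?orbT.
Qed.

End Ideals.

(** * The Hilbert basis theorem *)

Section Span.
Variable R : comPzRingType.

Definition ideal_span (s : seq R) : set R :=
  [set x | forall J : set R, is_ideal J -> (forall y, y \in s -> J y) -> J x].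

Lemma ideal_spanP s : is_ideal (ideal_span s).
Proof.
split=> [J iJ _|a x y sx sy J iJ sJ]; first exact: ideal0.
by apply: idealD => //; [apply: ideal_mull => //; exact: sx | exact: sy].
Qed.

Lemma mem_ideal_span (s : seq R) x : x \in s -> ideal_span s x.
Proof. by move=> xs J _; exact. Qed.

Lemma ideal_spanS (s t : seq R) : {subset s <= t} -> ideal_span s `<=` ideal_span t.
Proof. by move=> st x sx J iJ tJ; apply: sx => // y /st; exact: tJ. Qed.

Lemma noetherian_span (I : set R) : noetherian R -> is_ideal I ->
  exists2 s : seq R, (forall y, y \in s -> I y) & I `<=` ideal_span s.
Proof.
move=> hN iI; have [n [g E]] := hN _ iI; exists (codom g).
  move=> _ /codomP[i ->]; rewrite E; exists (fun j => (j == i)%:R).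
  rewrite (bigD1 i) //= eqxx mul1r big1 ?addr0 // => j /negPf ->; by rewrite mul0r.
rewrite E => _ [c ->] J iJ gJ; apply: ideal_sum => // i _; apply: ideal_mull => //.
by apply: gJ; exact: codom_f.
Qed.

Lemma span_noetherian : (forall I : set R, is_ideal I ->
    exists2 s : seq R, (forall y, y \in s -> I y) & I `<=` ideal_span s) ->
  noetherian R.
Proof.
move=> H I iI; have [s sI Is] := H _ iI.
exists (size s), (fun i => s`_i); apply/seteqP; split=> [x /Is|x [c ->]].
  apply.
    split; first by exists (fun=> 0); rewrite big1 // => i _; rewrite mul0r.
    move=> a _ _ [c ->] [d ->]; exists (fun i => a * c i + d i).
    by rewrite big_distrr -big_split /=; apply: eq_bigr => i _; ring.
  move=> y ys; have ys' : (index y s < size s)%N by rewrite index_mem.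
  exists (fun i => (i == Ordinal ys')%:R).
  rewrite (bigD1 (Ordinal ys')) //= eqxx mul1r nth_index // big1 ?addr0 //.
  by move=> i /negPf ->; rewrite mul0r.
by apply: ideal_sum => // i _; apply: ideal_mull => //; apply: sI; exact: mem_nth.
Qed.

End Span.

Section Hilbert.
Variable A : idomainType.

(** Bounding the size, instead of fixing it, lets in the cases where the leading terms cancel, so
    that this is an ideal. *)
Definition coef_ideal (I : set {poly A}) n : set A :=
  [set a | exists f, [/\ I f, (size f <= n.+1)%N & f`_n = a]].

Lemma coef_idealP I n : is_ideal I -> is_ideal (coef_ideal I n).
Proof.
move=> iI; split.
  by exists 0; rewrite size_poly0 coef0; split=> //; exact: ideal0.
move=> a _ _ [f [If sf <-]] [g [Ig sg <-]]; exists (a%:P * f + g); split.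
- by apply: idealD => //; exact: ideal_mull.
- rewrite (leq_trans (size_polyD _ _)) // geq_max sg andbT.
  by rewrite mul_polyC (leq_trans (size_scale_leq _ _)).
- by rewrite coefD coefCM.
Qed.

Lemma coef_ideal_mono I n m : is_ideal I -> (n <= m)%N ->
  coef_ideal I n `<=` coef_ideal I m.
Proof.
move=> iI nm _ [f [If sf <-]]; exists (f * 'X^(m - n)); split.
- exact: ideal_mulr.
- have [->|f0] := eqVneq f 0; first by rewrite mul0r size_poly0.
  rewrite size_mulXn //; lia.
- by rewrite coefMXn ltnNge leq_subr /= subKn.
Qed.

Theorem hilbert_basis : noetherian A -> noetherian {poly A}.
Proof.
move=> hN; apply: span_noetherian => I iI.
have [||_ [N _ <-] Nmax] :=
    @acc _ hN [set J | exists2 n, True & coef_ideal I n = J].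
- by exists (coef_ideal I 0), 0.
- by move=> _ [n _ <-]; exact: coef_idealP.
(* The chain of coefficient ideals stops at [N], so generators that serve the finitely many degrees
   up to [N] serve all degrees. *)
have key n : exists2 s : seq {poly A}, (forall y, y \in s -> I y) &
    forall m, (m <= n)%N -> coef_ideal I m `<=` coef_ideal (ideal_span s) m.
  have one m : exists2 s : seq {poly A}, (forall y, y \in s -> I y) &
      coef_ideal I m `<=` coef_ideal (ideal_span s) m.
    have [s sI Is] := noetherian_span hN (coef_idealP m iI).
    have [t tI st] : exists2 t : seq {poly A}, (forall y, y \in t -> I y) &
        forall y, y \in s -> coef_ideal (ideal_span t) m y.
      elim: s sI {Is} => [|a s IH] sI; first by exists [::].
      have [y ys|t tI st] := IH; first by apply: sI; rewrite inE ys orbT.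
      have [f [If sf fa]] := sI a (mem_head _ _).
      exists (f :: t) => y; rewrite inE => /predU1P[->//|]; first exact: tI.
        by exists f; split=> //; apply: mem_ideal_span; exact: mem_head.
      move=> /st[g [tg sg gy]]; exists g; split=> //.
      by apply: ideal_spanS tg => z zt; rewrite inE zt orbT.
    exists t => // a ca; apply: (Is a ca) => //; exact/coef_idealP/ideal_spanP.
  elim: n => [|n [s sI sP]].
    by have [s sI sP] := one 0; exists s => // m; rewrite leqn0 => /eqP->.
  have [t tI tP] := one n.+1; exists (s ++ t).
    by move=> y; rewrite mem_cat => /orP[/sI|/tI].
  have mono u m : {subset u <= s ++ t} ->
      coef_ideal (ideal_span u) m `<=` coef_ideal (ideal_span (s ++ t)) m.
    move=> us _ [f [uf sf <-]]; exists f; split=> //; by move: f uf {sf}; exact: ideal_spanS.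
  move=> m; rewrite leq_eqVlt => /predU1P[->|mn] a.
    by move=> /tP; apply: mono => y yt; rewrite mem_cat yt orbT.
  by move=> /(sP _ mn); apply: mono => y yt; rewrite mem_cat yt.
have [s sI sP] := key N; exists s => // f If.
have {}sP n : coef_ideal I n `<=` coef_ideal (ideal_span s) n.
  have [|/ltnW Nn] := leqP n N; first exact: sP.
  rewrite (Nmax (coef_ideal I n)); last exact: coef_ideal_mono.
    apply: subset_trans (sP _ (leqnn N)) _.
    by apply: coef_ideal_mono Nn; exact: ideal_spanP.
  by exists n.
have iS := ideal_spanP s.
(* Subtracting an element [g] of the span with the same leading coefficient lowers the degree. *)
have [n] := ubnP (size f); elim: n f If => // n IH f If sf.
have [->|f0] := eqVneq f 0; first exact: ideal0.
have [|g [sg sgf gf]] := sP (size f).-1 (lead_coef f).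
  by exists f; split=> //; rewrite prednK ?size_poly_gt0.
rewrite prednK ?size_poly_gt0 // in sgf.
have fgg : f = (f - g) + g by rewrite subrK.
rewrite fgg; apply: (@idealD _ _ (f - g) g) => //; first apply: IH.
  apply: idealB => //; exact: sg.
suff : (size (f - g)%R < size f)%N by move=> h; exact: leq_trans h sf.
have le : (size (f - g)%R <= size f)%N.
  by rewrite (leq_trans (size_polyD _ _)) // size_polyN geq_max leqnn.
rewrite ltn_neqAle le andbT; apply/negP => /eqP e.
have : lead_coef (f - g) = 0 by rewrite lead_coefE e coefB gf lead_coefE subrr.
by move/eqP; rewrite lead_coef_eq0 -size_poly_eq0 e size_poly_eq0 (negPf f0).
Qed.

End Hilbert.

(** * Complete integral closedness *)

(** Complete integral closedness, without fractions: if all the powers of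
    [a / b] have a common denominator [d], then [a / b] lies in [A]. *)
Definition completely_integrally_closed (A : idomainType) : Prop :=
  forall a b d : A, b != 0 -> d != 0 ->
    (forall n, exists c, d * a ^+ n = c * b ^+ n) -> exists c, a = c * b.

Lemma ideal_span_mkseq (R : comPzRingType) (c : nat -> R) k x :
  ideal_span (mkseq c k) x -> exists r : nat -> R, x = \sum_(i < k) r i * c i.
Proof.
move=> h; apply: (h [set x | exists r : nat -> R, x = \sum_(i < k) r i * c i]); first split.
- by exists (fun=> 0); rewrite big1 // => i _; rewrite mul0r.
- move=> a _ _ [r ->] [r' ->]; exists (fun i => a * r i + r' i).
  by rewrite big_distrr -big_split /=; apply: eq_bigr => i _; ring.
- move=> _ /mapP[i ik ->]; rewrite mem_iota add0n in ik.
  exists (fun j => (j == i)%:R); rewrite (bigD1 (Ordinal ik)) //= eqxx mul1r.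
  rewrite big1 ?addr0 // => j; rewrite -val_eqE /= => /negPf ->; by rewrite mul0r.
Qed.

(** With [x = a / b], the elements [c n = d * x ^+ n] of [A] generate an ascending chain of ideals.
    Where it stops, [c N] is a combination of the earlier ones, and cancelling [d] leaves a monic
    equation for [x]. *)
Lemma normal_cic (A : idomainType) : noetherian A -> normal_domain A ->
  completely_integrally_closed A.
Proof.
move=> hN hA a b d b0 d0 /choice[c cE].
have F0 (y : A) : (tofrac y == 0) = (y == 0) := tofrac_eq0 y.
pose x : {fraction A} := tofrac a / tofrac b.
have xE n : tofrac (c n) = tofrac d * x ^+ n.
  rewrite /x expr_div_n mulrA -tofracXn -tofracXn -tofracM cE tofracM mulfK //.
  by rewrite F0 expf_neq0.
have [||_ [N _ <-] Nmax] := @acc _ hN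
    [set J | exists2 n, True & ideal_span (mkseq c n) = J].
- by exists (ideal_span (mkseq c 0)), 0%N.
- by move=> _ [n _ <-]; exact: ideal_spanP.
have [r rE] : exists r : nat -> A, c N = \sum_(i < N) r i * c i.
  apply: ideal_span_mkseq; rewrite -(Nmax (ideal_span (mkseq c N.+1))).
  - by apply: mem_ideal_span; rewrite /mkseq map_f // mem_iota add0n /=.
  - by exists N.+1.
  - apply: ideal_spanS => _ /mapP[i iN ->]; apply/mapP; exists i => //.
    by move: iN; rewrite !mem_iota !add0n /=; lia.
have [|e xe] := hA x.
  exists ('X^N - \poly_(i < N) r i).
    rewrite monicE lead_coefDl ?lead_coefXn // size_polyXn size_polyN.
    by rewrite ltnS size_poly.
  rewrite /root rmorphB /= map_polyXn hornerD hornerN hornerXn.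
  rewrite poly_def rmorph_sum /= horner_sum subr_eq0.
  rewrite -(inj_eq (mulfI (_ : tofrac d != 0))) ?F0 // -xE rE rmorph_sum big_distrr /=.
  apply/eqP/eq_bigr => i _.
  by rewrite map_polyZ map_polyXn hornerZ hornerXn rmorphM /= xE; ring.
exists e; apply/eqP; rewrite -tofrac_eq; apply/eqP.
by rewrite rmorphM /= -xe /x mulfVK // F0.
Qed.

Section PolyCIC.
Variable A : idomainType.
Hypothesis hA : completely_integrally_closed A.

(** Induction on the size of [k]: the relations between leading coefficients and the property of [A]
    give [lead_coef k = r * c], and removing the leading term [c%:P * t] preserves the hypothesis on
    powers. *)
Lemma poly_cic_const (k : {poly A}) (c : A) (d : {poly A}) : c != 0 -> d != 0 ->
  (forall n, exists e, d * k ^+ n = c%:P ^+ n * e) -> exists e, k = c%:P * e.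
Proof.
move=> c0 d0; have [m] := ubnP (size k); elim: m k => // m IH k sk H.
have [->|k0] := eqVneq k 0; first by exists 0; rewrite mulr0.
have [||r rE] := hA (a := lead_coef k) (d := lead_coef d) c0.
- by rewrite lead_coef_eq0.
- move=> n; have [e] := H n; move/(congr1 lead_coef).
  rewrite lead_coefM lead_coef_exp -polyC_exp mul_polyC lead_coefZ.
  by move=> ->; exists (lead_coef e); rewrite mulrC.
pose t : {poly A} := r%:P * 'X^((size k).-1).
have ktE : k = (k - c%:P * t) + c%:P * t by rewrite subrK.
have [||e eE] := IH (k - c%:P * t).
- suff : (size (k - c%:P * t)%R < size k)%N by move=> h; exact: leq_trans h sk.
  have ct : c%:P * t = lead_coef k *: 'X^((size k).-1).
    by rewrite mulrA -polyCM mul_polyC mulrC rE.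
  have le : (size (k - c%:P * t)%R <= size k)%N.
    rewrite (leq_trans (size_polyD _ _)) // size_polyN geq_max leqnn ct.
    by rewrite (leq_trans (size_scale_leq _ _)) // size_polyXn prednK ?size_poly_gt0.
  rewrite ltn_neqAle le andbT; apply/negP => /eqP e.
  have : lead_coef (k - c%:P * t) = 0.
    by rewrite lead_coefE e coefB ct coefZ coefXn eqxx mulr1 subrr.
  by move/eqP; rewrite lead_coef_eq0 -size_poly_eq0 e size_poly_eq0 (negPf k0).
- move=> n; have /choice[e eE] := H.
  (* In the binomial expansion, [c ^+ (n - i)] comes from [d * k ^+ (n - i)] and [c ^+ i] from the
     power of [c%:P * t]; together they give [c ^+ n]. *)
  exists (\sum_(i < n.+1) (-1) ^+ i * e (n - i)%N * t ^+ i *+ 'C(n, i)).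
  rewrite exprBn !big_distrr /=; apply: eq_bigr => i _.
  have -> : c%:P ^+ n = c%:P ^+ (n - i) * c%:P ^+ i :> {poly A}.
    by rewrite -exprD subnK // -ltnS.
  rewrite exprMn !mulrnAr; congr (_ *+ _).
  move: (eE (n - i)%N) => E.
  transitivity (d * k ^+ (n - i) * ((-1) ^+ i * (c%:P ^+ i * t ^+ i))); first by ring.
  by rewrite E; ring.
by exists (e + t); rewrite mulrDr -eE subrK.
Qed.

(** Divisibility over the fraction field of [A] first gives [f / h] a constant denominator [c],
    which [poly_cic_const] then removes. *)
Lemma poly_cic : completely_integrally_closed {poly A}.
Proof.
move=> f h d h0 d0 H.
have [c c0 [k kE]] : exists2 c : A, c != 0 & exists k, c *: f = k * h.
  have /Pdiv.Idomain.dvdpP[[c k] /= c0 kE] : h %| f; last by exists c => //; exists k.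
  have Hd n : h ^+ n %| d * f ^+ n.
    by have [e ->] := H n; exact: dvdp_mulIr.
  set g := gcdp f h.
  have g0 : g != 0 by rewrite gcdp_eq0 negb_and h0 orbT.
  have split_g p : g %| p -> p %= (p %/ g) * g.
    move=> gp; rewrite Pdiv.Idomain.divpK // eqp_sym eqp_scale //.
    by rewrite expf_neq0 // lead_coef_eq0.
  have hE := split_g h (dvdp_gcdr _ _); have fE := split_g f (dvdp_gcdl _ _).
  set f' := f %/ g in fE; set h' := h %/ g in hE.
  (* [h'] is the denominator in lowest terms. Coprimality turns the hypothesis into [h' ^+ n %| d]
     for all [n], which forces [h'] to have degree zero. *)
  have cop : coprimep h' f' by rewrite coprimep_sym coprimep_div_gcd // h0 orbT.
  have h'd n : h' ^+ n %| d.
    have : (h' * g) ^+ n %| d * (f' * g) ^+ n.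
      have := Hd n.
      by rewrite (eqp_dvdl _ (eqp_exp n hE)) (eqp_dvdr _ (eqp_mull d (eqp_exp n fE))).
    rewrite !exprMn mulrA dvdp_mul2r ?expf_neq0 // Gauss_dvdpl //.
    by rewrite coprimep_expl // coprimep_expr.
  have h'0 : h' != 0.
    by apply/eqP => e; move: hE; rewrite e mul0r eqp0 (negPf h0).
  have sh' : size h' == 1.
    rewrite eqn_leq size_poly_gt0 h'0 andbT leqNgt; apply/negP => s1.
    have := dvdp_leq d0 (h'd (size d)); have := size_exp h' (size d).
    have : (0 < size d)%N by rewrite size_poly_gt0.
    case: (size h') s1 => [|[|k]] // _ /=; rewrite mulSn.
    move: (size (h' ^+ size d)) (k * size d)%N => u v; lia.
  rewrite size_poly_eq1 in sh'.
  rewrite (eqp_dvdl _ hE) (eqp_dvdl _ (eqp_mulr g sh')) mul1r.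
  exact: dvdp_gcdl.
have C0 : c%:P != 0 :> {poly A} by rewrite polyC_eq0.
have [|e eE] := @poly_cic_const k c d c0 d0.
  move=> n; have [e eE] := H n; exists e.
  apply: (mulIf (expf_neq0 n h0)).
  rewrite -mulrA -exprMn -kE -mul_polyC exprMn -mulrA -eE; ring.
exists e; apply: (mulfI C0); rewrite mul_polyC kE eE; ring.
Qed.
End PolyCIC.

(** * Primes of height one *)

(** The multiplier [k] exhibits the goal as a consequence of a hypothesis; a polynomial identity for
    [ring] remains. *)
Lemma lincomb1 (R : comPzRingType) (k l r x y : R) :
  l = r -> x - y = k * (l - r) -> x = y.
Proof. by move=> -> e; apply/subr0_eq; rewrite e subrr mulr0. Qed.

Lemma lincomb2 (R : comPzRingType) (k k' l r l' r' x y : R) :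
  l = r -> l' = r' -> x - y = k * (l - r) + k' * (l' - r') -> x = y.
Proof. by move=> -> -> e; apply/subr0_eq; rewrite e !subrr !mulr0 addr0. Qed.

Section Primes.
Variables (R : comPzRingType) (p : Spec R).

Lemma spec_ideal : is_ideal (spec_set p). Proof. by case: (spec_prime p). Qed.
Lemma spec0 : spec_set p 0. Proof. exact: ideal0 spec_ideal. Qed.
Lemma specMl x y : spec_set p y -> spec_set p (x * y).
Proof. exact: ideal_mull spec_ideal. Qed.
Lemma specMr x y : spec_set p x -> spec_set p (x * y).
Proof. exact: ideal_mulr spec_ideal. Qed.
Lemma specD x y : spec_set p x -> spec_set p y -> spec_set p (x + y).
Proof. exact: idealD spec_ideal. Qed.
Lemma spec_nmemX x n : ~ spec_set p x -> ~ spec_set p (x ^+ n).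
Proof.
move=> px; elim: n => [|n IH]; first by rewrite expr0; exact: spec_nmem1.
by rewrite exprS; exact: spec_nmemM.
Qed.
Lemma spec_sum (T : Type) (s : seq T) (Q : pred T) (F : T -> R) :
  (forall i, Q i -> spec_set p (F i)) -> spec_set p (\sum_(i <- s | Q i) F i).
Proof. exact: ideal_sum spec_ideal. Qed.
End Primes.

Lemma spec_inj (R : comPzRingType) (p q : Spec R) :
  p `<=` q -> q `<=` p -> p = q.
Proof.
move=> pq qp; have : spec_set p = spec_set q by apply/seteqP.
case: p q {pq qp} => p pP [q qP] /= e; subst q; congr MkSpec; exact: Prop_irrelevance.
Qed.

Lemma primeDivisor_inj (A : idomainType) (p q : primeDivisor A) :
  p `<=` q -> q `<=` p -> p = q.
Proof.
move=> pq qp; have : pd_point p = pd_point q by exact: spec_inj.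
case: p q {pq qp} => p pP [q qP] /= e; subst q.
congr MkPrimeDivisor; exact: Prop_irrelevance.
Qed.

Lemma primeDivisor_sub (A : idomainType) (p q : primeDivisor A) : p `<=` q -> p = q.
Proof.
move=> pq; have [[x px x0] _] := pd_height p.
have [_ /(_ p pq)[h|qp]] := pd_height q; last exact: primeDivisor_inj.
by have := h _ px => /= /eqP; rewrite (negPf x0).
Qed.

(** For [b != 0] this means that [a / b] lies in the localization at [q]. *)
Definition local_dvd (A : idomainType) (q : Spec A) (b a : A) : Prop :=
  exists s r, ~ spec_set q s /\ s * a = r * b.

(** [t] generates the maximal ideal of the localization at [p]; for a noetherian domain this makes
    the localization a discrete valuation ring. *)
Definition local_gen (A : idomainType) (p : Spec A) (t : A) : Prop :=
  [/\ spec_set p t, t != 0 & forall x, spec_set p x -> local_dvd p t x].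

(** If [c / b] mapped [P] into itself, it would be almost integral. *)
Lemma colon_local_gen (A : idomainType) (P : Spec A) (b c : A) :
  completely_integrally_closed A -> b != 0 ->
  (forall r, spec_set P r <-> exists k, r * c = k * b) -> exists t, local_gen P t.
Proof.
move=> hC b0 Pbc.
have [[x [k [Px kE Pk]]]|nk] :=
    pselect (exists x k, [/\ spec_set P x, x * c = k * b & ~ spec_set P k]).
  (* [k] is a unit at [P]; comparing [x * c = k * b] with [z * c = r * b] gives [k * z = r * x]. *)
  exists x; split=> //.
    have Pb : spec_set P b by apply/Pbc; exists c; rewrite mulrC.
    have [k0|k0] := eqVneq k 0; first by case: Pk; rewrite k0; exact: spec0.
    apply: contra_neq (mulf_neq0 k0 b0) => x0; by rewrite -kE x0 mul0r.
  move=> z /Pbc[r rE]; exists k, r; split=> //.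
  apply: (mulIf b0) => /=; ring: (esym kE) (esym rE).
exfalso; have Pb : spec_set P b by apply/Pbc; exists c; rewrite mulrC.
have [|e eE] := hC c b b b0 b0; last first.
  by apply: (@spec_nmem1 _ P); apply/Pbc; exists e; rewrite mul1r.
have H n : exists2 e, spec_set P e & b * c ^+ n = e * b ^+ n.
  elim: n => [|n [e Pe eE]]; first by exists b => //; rewrite !expr0.
  have /Pbc[k kE] := Pe; exists k.
    by apply: contrapT => Pk; apply: nk; exists e, k.
  by rewrite exprSr mulrA eE -mulrA [_ ^+ n * c]mulrC mulrA kE exprS; ring.
by move=> n; have [e _ eE] := H n; exists e.
Qed.

Section Core.
Variable A : idomainType.
Hypotheses (hN : noetherian A) (hC : completely_integrally_closed A).

(** Among the ideals [{r | r c in b A_q}] with [c] a multiple of [a], a maximal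
    proper one is prime, and normality makes its local ring a valuation ring. *)
Lemma exists_local_gen_prime (q : Spec A) (a b : A) : b != 0 -> ~ local_dvd q b a ->
  exists p : Spec A, [/\ p `<=` q, exists t, local_gen p t & ~ local_dvd p b a].
Proof.
move=> b0 nab.
pose X c : set A := [set r | local_dvd q b (r * c)].
have iX c : is_ideal (X c).
  split; first by exists 1, 0; rewrite !mul0r mulr0; split=> //; exact: spec_nmem1.
  move=> z x y [s [r [qs e]]] [s' [r' [qs' e']]].
  exists (s * s'), (z * r * s' + r' * s); split; first exact: spec_nmemM.
  by apply: (lincomb2 (k := z * s') (k' := s) e e'); ring.
have [||M [c [-> [[y cE] X1]]] Xmax] :=
    @acc _ hN [set J | exists c, J = X c /\ (exists y, c = a * y) /\ ~ X c 1].
- by exists (X a), a; split=> //; split; [exists 1; rewrite mulr1 | rewrite /X /= mul1r].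
- by move=> _ [c [-> _]].
have Xq : X c `<=` q.
  move=> r [s [k [qs e]]]; apply: contrapT => qr; apply: X1.
  by exists (s * r), k; rewrite mul1r -mulrA; split=> //; exact: spec_nmemM.
have pX : is_prime (X c).
  split=> // u v Xuv; have [Xu|Xu] := pselect (X c u); [by left | right].
  (* [X (c * u)] contains [X c] and is proper because [u] is not in [X c], so maximality applies. *)
  have e : X (c * u) = X c.
    apply: Xmax; first exists (c * u).
      split=> //; split; first by exists (y * u); rewrite cE mulrA.
      by rewrite /X /= mul1r mulrC.
    move=> r [s [k [qs e]]]; exists s, (k * u); split=> //; ring: e.
  rewrite -e; case: Xuv => s [k [qs e']]; exists s, k; split=> //; ring: e'.
pose P := MkSpec pX.
have [s sP] := noetherian_span hN (iX c).
(* [X c] is a colon ideal only up to denominators outside [q]. A common denominator [w] for finitely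
   many generators makes it the colon ideal of [b] by [w * c], which [colon_local_gen] requires. *)
move=> Xs; have [w [qw wP]] : exists w, ~ spec_set q w /\
    forall r, r \in s -> exists k, w * (r * c) = k * b.
  elim: s sP {Xs} => [|r s IH] sP; first by exists 1; split=> //; exact: spec_nmem1.
  have [|w [qw wP]] := IH; first by move=> z zs; apply: sP; rewrite inE zs orbT.
  have [v [k [qv e]]] := sP r (mem_head _ _).
  exists (w * v); split; first exact: spec_nmemM.
  move=> z; rewrite inE => /predU1P[->|/wP[k' e']].
    by exists (w * k); ring: e.
  by exists (v * k'); ring: e'.
exists P; split=> //.
  apply: (@colon_local_gen _ _ b (w * c)) => // r; split.
    move=> /Xs h; apply: (h [set r | exists k, r * (w * c) = k * b]).
      split; first by exists 0; rewrite !mul0r.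
      by move=> z u v [k e] [k' e']; exists (z * k + k');
        apply: (lincomb2 (k := z) (k' := 1) e e'); ring.
    by move=> z /wP[k e]; exists k; ring: e.
  by move=> [k e]; exists w, k; split=> //; ring: e.
move=> [s' [r [Ps e]]]; apply: Ps; exists 1, (r * y); split; first exact: spec_nmem1.
by rewrite cE; ring: e.
Qed.

End Core.

(** * Orders along prime divisors *)

Section Fractions.
Variable A : idomainType.
Implicit Types (a b : A) (x y : {fraction A}).

Lemma fracW x : exists a b, b != 0 /\ x = tofrac a / tofrac b.
Proof.
have [r ->] : exists r, x = \pi_{fraction A} r by exists (repr x); rewrite reprK.
exists (frac r).1, (frac r).2; have d0 := denom_ratioP r; split=> //.
have dF : tofrac (frac r).2 != 0 by rewrite tofrac_eq0.
apply: (mulIf dF); rewrite mulfVK //.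
unlock tofrac.
rewrite -[_ * _]/(FracField.mul _ _) !piE /FracField.mulf.
apply/eqmodP; rewrite /= FracField.equivfE.
rewrite !numden_Ratio ?oner_eq0 ?mulr1 ?mul1r ?mulf_neq0 //.
by rewrite mulrC.
Qed.

Lemma tofrac_inj : injective (@tofrac A).
Proof. by move=> a b /eqP; rewrite tofrac_eq => /eqP. Qed.

Lemma frac_eq a b c d : b != 0 -> d != 0 ->
  (tofrac a / tofrac b = tofrac c / tofrac d) <-> (a * d = c * b).
Proof.
move=> b0 d0; split=> e.
  apply: tofrac_inj; rewrite !tofracM; apply/eqP.
  by rewrite -eqr_div ?tofrac_eq0 // e.
apply/eqP; rewrite eqr_div ?tofrac_eq0 //.
by rewrite -!tofracM e.
Qed.

End Fractions.

Section LocalRing.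
Variables (A : idomainType) (p : Spec A).

Lemma mklocM a s b t (ps : ~ spec_set p s) (pt : ~ spec_set p t) :
  mkloc a ps * mkloc b pt = mkloc (a * b) (spec_nmemM ps pt).
Proof. exact: loc_mulE. Qed.

Lemma mklocX a s (ps : ~ spec_set p s) n :
  mkloc a ps ^+ n = mkloc (a ^+ n) (spec_nmemX (n := n) ps).
Proof.
elim: n => [|n IH]; first by apply: mkloc_eq; rewrite !expr0.
by rewrite exprS IH mklocM; apply: mkloc_eq; rewrite !exprS; ring.
Qed.

Lemma spec_nmem_neq0 s : ~ spec_set p s -> s != 0.
Proof. by move=> ps; apply/eqP => s0; apply: ps; rewrite s0; exact: spec0. Qed.

Lemma mkloc_dom a s b t (ps : ~ spec_set p s) (pt : ~ spec_set p t) :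
  mkloc a ps = mkloc b pt <-> a * t = b * s.
Proof.
split=> [/mkloc_eqP[u pu]|]; last exact: mkloc_eq.
by move/(mulfI (spec_nmem_neq0 pu)).
Qed.

Lemma mkloc_unit a s (ps : ~ spec_set p s) : loc_unit (mkloc a ps) <-> ~ spec_set p a.
Proof.
split=> [[y]|pa].
  have [b [t [pt ->]]] := locW y; rewrite mklocM.
  rewrite -[1]/(mkloc 1 (@spec_nmem1 _ p)) => /mkloc_dom; rewrite mulr1 mul1r => e pa.
  by apply: (spec_nmemM ps pt); rewrite -e; exact: specMr.
exists (mkloc s pa); rewrite mklocM -[1]/(mkloc 1 (@spec_nmem1 _ p)).
by apply: mkloc_eq; ring.
Qed.

End LocalRing.

Section Order.
Variables (A : idomainType).

Lemma local_gen_uniformizer (p : Spec A) t :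
  local_gen p t -> uniformizer (mkloc t (@spec_nmem1 _ p)).
Proof.
move=> [pt t0 gen] x; have [a [s [ps ->]]] := locW x; split.
  move=> nu; have /gen[k [r [pk e]]] : spec_set p a.
    by apply: contrapT => /(mkloc_unit _ ps).
  exists (mkloc r (spec_nmemM pk ps)); rewrite mklocM; apply: mkloc_eq.
  by ring: e.
move=> [y]; have [b [v [pv ->]]] := locW y; rewrite mklocM => /mkloc_dom e.
move=> /mkloc_unit pa; apply: (spec_nmemM pa (spec_nmemM (@spec_nmem1 _ p) pv)).
by rewrite e -mulrA; exact: specMr.
Qed.

(** The definition of the order leaves the uniformizer [tau] free. It divides [t] and is divided by
    it, so the two differ by a unit [z], whose power is absorbed into [u]. *)
Lemma has_order_intE (p : primeDivisor A) t f n : local_gen p t ->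
  has_order_int p f n <->
  exists s u, [/\ ~ spec_set p s, ~ spec_set p u & s * f = u * t ^+ n].
Proof.
move=> lt; have [pt t0 gen] := lt; split; last first.
  move=> [s [u [ps pu e]]]; exists (mkloc t (@spec_nmem1 _ p)), (mkloc u ps).
  split; [exact: local_gen_uniformizer | exact/mkloc_unit|].
  by rewrite mklocX mklocM; apply: mkloc_eq; rewrite expr1n; ring: e.
move=> [tau [ups [tauP]]].
have [v [s [ps ->]]] := locW ups => /mkloc_unit pv.
have [y yE] : exists y, mkloc t (@spec_nmem1 _ p) = tau * y.
  by apply/tauP; move=> /mkloc_unit.
have ntau : ~ loc_unit tau by apply/tauP; exists 1; rewrite mulr1.
have [z zE] := (local_gen_uniformizer lt tau).1 ntau.
have zu : loc_unit z.
  exists y; move: zE yE; have [b [k [pk ->]]] := locW y; have [c [l [pl ->]]] := locW z.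
  move=> ->; rewrite !mklocM => /mkloc_dom e.
  rewrite -[1]/(mkloc 1 (@spec_nmem1 _ p)); apply/mkloc_dom.
  by apply: (mulfI t0); apply: (lincomb1 (k := -1) e); ring.
rewrite zE exprMn; have [c [l [pl zE']]] := locW z.
move: zu; rewrite zE' => /mkloc_unit pc.
rewrite !mklocX [mkloc (t ^+ n) _ * _]mklocM mklocM => /mkloc_dom e.
exists (s * l ^+ n), (v * c ^+ n); split.
- by apply: spec_nmemM => //; exact: spec_nmemX.
- by apply: spec_nmemM => //; exact: spec_nmemX.
- by move: e; rewrite expr1n => e; apply: (lincomb1 (k := 1) e); ring.
Qed.

End Order.

Section Krull.
Variable A : idomainType.
Hypotheses (hN : noetherian A) (hC : completely_integrally_closed A).

(** Krull's intersection argument. If [t] could be split off forever, take [N] where the chain [J]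
    stops: [f] is locally [r * t ^+ N.+1] with [r] in [J N.+1 = J N], so [f] divides [r * t ^+ N]
    and [t] would be a unit. *)
Lemma local_gen_expansion (p : Spec A) t f : local_gen p t -> f != 0 ->
  exists n s u, [/\ ~ spec_set p s, ~ spec_set p u & s * f = u * t ^+ n].
Proof.
move=> [pt t0 gen] f0; apply: contrapT => nex.
have divides n : exists s r, ~ spec_set p s /\ s * f = r * t ^+ n.
  elim: n => [|n [s [r [ps e]]]].
    by exists 1, f; split; [exact: spec_nmem1 | rewrite expr0; ring].
  have /gen[s' [r' [ps' e']]] : spec_set p r.
    by apply: contrapT => pr; apply: nex; exists n, s, r.
  exists (s' * s), r'; split; first exact: spec_nmemM.
  by rewrite exprS; apply: (lincomb2 (k := s') (k' := t ^+ n) e e'); ring.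
pose J n : set A := [set r | local_dvd p f (r * t ^+ n)].
have iJ n : is_ideal (J n).
  split; first by exists 1, 0; rewrite !mul0r mulr0; split=> //; exact: spec_nmem1.
  move=> z x y [s [r [qs e]]] [s' [r' [qs' e']]].
  exists (s * s'), (z * r * s' + r' * s); split; first exact: spec_nmemM.
  by apply: (lincomb2 (k := z * s') (k' := s) e e'); ring.
have [||_ [N _ <-] Nmax] := @acc _ hN [set K | exists2 n, True & J n = K].
- by exists (J 0), 0.
- by move=> _ [n _ <-].
have [s [r [ps e]]] := divides N.+1.
have : J N.+1 r by exists 1, s; rewrite mul1r e; split=> //; exact: spec_nmem1.
rewrite (Nmax (J N.+1)); first last.
- move=> x [s' [k [ps' e']]]; exists s', (k * t); split=> //.
  by rewrite exprS; apply: (lincomb1 (k := t) e'); ring.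
- by exists N.+1.
move=> [s' [k [ps' e']]]; apply: (spec_nmemM ps ps').
suff -> : s * s' = k * t by exact: specMl.
apply: (mulIf f0) => /=; rewrite exprS in e.
by apply: (lincomb2 (k := s') (k' := t) e e'); ring.
Qed.

(** A non-zero [f] in a prime [q] inside [p] is locally a unit times a power of [t]. Hence [t] lies
    in [q], and with it all of [p]. *)
Lemma local_gen_height_one (p : Spec A) t : local_gen p t -> height_one p.
Proof.
move=> lt; have [pt t0 gen] := lt; split; first by exists t.
move=> q qp; have [q0|/existsNP[f /not_implyP[qf f0]]] := pselect (q `<=` [set 0]).
  by left.
right; have [|n [s [u [ps pu e]]]] := local_gen_expansion lt (f := f).
  exact/eqP.
have [_ _ qP] := spec_prime q.
have qt : spec_set q t.
  have : spec_set q (u * t ^+ n) by rewrite -e; exact: specMl.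
  move=> /qP[/qp //|]; apply: contraPP; exact: spec_nmemX.
move=> x /gen[k [r [pk e']]].
have : spec_set q (k * x) by rewrite e'; exact: specMl.
by move=> /qP[/qp|].
Qed.

Lemma exists_prime_divisor (q : Spec A) (a b : A) : b != 0 -> ~ local_dvd q b a ->
  exists p : primeDivisor A, p `<=` q /\ ~ local_dvd p b a.
Proof.
move=> b0 /(exists_local_gen_prime hN hC b0)[p [pq [t lt] h]].
by exists (MkPrimeDivisor (local_gen_height_one lt)).
Qed.

(** Take a non-zero [b] in [p]. As [1 / b] is not in the localization at [p], some non-zero prime
    inside [p] has a local generator; by height one it is [p] itself. *)
Lemma prime_divisor_gen (p : primeDivisor A) : exists t, local_gen p t.
Proof.
have [[b pb b0] hp] := pd_height p.
have [|q [qp [t lt] _]] := exists_local_gen_prime hN hC (q := p) (a := 1) b0.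
  by move=> [s [r [ps e]]]; apply: ps; rewrite -[s]mulr1 e; exact: specMl.
exists t; have [qt t0 _] := lt; have [q0|pq] := hp q qp.
  by have := q0 _ qt => /= /eqP; rewrite (negPf t0).
by have -> : pd_point p = q by exact: spec_inj.
Qed.

Definition lgen (p : primeDivisor A) : A := xget 0 (local_gen p).

Lemma lgenP (p : primeDivisor A) : local_gen p (lgen p).
Proof. by have [t lt] := prime_divisor_gen p; exact: xgetI lt. Qed.

(** A non-zero element has an order, so the default value is taken only at [a = 0]. The same holds
    for [ord] on fractions below. *)
Definition ordn (p : primeDivisor A) (a : A) : nat := xget 0%N (has_order_int p a).

Lemma ordn_has_order (p : primeDivisor A) a : a != 0 -> has_order_int p a (ordn p a).
Proof.
move=> a0; have [n h] := local_gen_expansion (lgenP p) a0.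
have h' : has_order_int p a n by apply/(has_order_intE _ _ (lgenP p)).
exact: xgetI h'.
Qed.

Lemma ordnP (p : primeDivisor A) a t : local_gen p t -> a != 0 ->
  exists s u, [/\ ~ spec_set p s, ~ spec_set p u & s * a = u * t ^+ ordn p a].
Proof. by move=> lt a0; apply/(has_order_intE _ _ lt)/ordn_has_order. Qed.

Lemma has_order_int_neq0 (p : primeDivisor A) a n : has_order_int p a n -> a != 0.
Proof.
move=> /(has_order_intE _ _ (lgenP p))[s [u [ps pu e]]]; apply/eqP => a0.
have [_ t0 _] := lgenP p.
move: e; rewrite a0 mulr0 => /esym/eqP; rewrite mulf_eq0 expf_eq0 (negPf t0) andbF orbF.
by rewrite (negPf (spec_nmem_neq0 pu)).
Qed.

Lemma ordn_ge (p : primeDivisor A) a t n : local_gen p t -> a != 0 ->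
  (n <= ordn p a)%N <-> local_dvd p (t ^+ n) a.
Proof.
move=> lt a0; have [s [u [ps pu e]]] := ordnP lt a0; have [pt t0 _] := lt.
move: (ordn p a) e => m e; split.
  move=> le; exists s, (u * t ^+ (m - n)); split=> //.
  by rewrite -mulrA -exprD subnK.
move=> [s' [r [ps' e']]]; rewrite leqNgt; apply/negP => lt'.
apply: (spec_nmemM ps' pu); suff -> : s' * u = s * r * t ^+ (n - m).-1 * t.
  exact: specMl.
apply: (mulIf (expf_neq0 m t0)) => /=.
rewrite -[s * r * _ * t]mulrA -exprSr prednK ?subn_gt0 //.
rewrite -[s * r * _ * _]mulrA -exprD subnK; last exact: ltnW.
by apply: (lincomb2 (k := - s') (k' := s) e e'); ring.
Qed.

Lemma has_order_ordn (p : primeDivisor A) a n : has_order_int p a n -> n = ordn p a.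
Proof.
move=> h; have a0 := has_order_int_neq0 h.
move: (lgenP p); move: (lgen p) => t lt; have [pt t0 _] := lt.
have /(has_order_intE _ _ lt)[s [u [ps pu e]]] := h.
apply/eqP; rewrite eqn_leq; apply/andP; split.
  by apply/(ordn_ge n lt a0); exists s, u.
rewrite leqNgt; apply/negP => /(ordn_ge _ lt a0)[s' [r [ps' e']]].
apply: (spec_nmemM ps' pu); suff -> : s' * u = s * r * t by exact: specMl.
apply: (mulIf (expf_neq0 n t0)) => /=; rewrite exprS in e'.
by apply: (lincomb2 (k := - s') (k' := s) e e'); ring.
Qed.

Lemma ordn_eq (p : primeDivisor A) a t n s u : local_gen p t ->
  ~ spec_set p s -> ~ spec_set p u -> s * a = u * t ^+ n -> ordn p a = n.
Proof.
by move=> lt ps pu e; apply/esym/has_order_ordn/(has_order_intE _ _ lt); exists s, u.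
Qed.

Lemma ordnM (p : primeDivisor A) a b : a != 0 -> b != 0 ->
  ordn p (a * b) = (ordn p a + ordn p b)%N.
Proof.
move=> a0 b0; have lt := lgenP p.
have [s [u [ps pu e]]] := ordnP lt a0; have [s' [u' [ps' pu' e']]] := ordnP lt b0.
apply: (ordn_eq (s := s * s') (u := u * u') lt); [exact: spec_nmemM.. |].
by rewrite exprD mulrACA e e' mulrACA.
Qed.

Lemma ordn_eq0 (p : primeDivisor A) a : ~ spec_set p a -> ordn p a = 0%N.
Proof.
move=> pa; apply: (ordn_eq (s := 1) (u := a) (lgenP p)) => //; first exact: spec_nmem1.
by rewrite expr0; ring.
Qed.

Lemma ordn_gt0 (p : primeDivisor A) a : a != 0 -> (0 < ordn p a)%N <-> spec_set p a.
Proof.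
move=> a0; split.
  by move=> h; apply: contrapT => /ordn_eq0 e; rewrite e in h.
have [pt t0 gen] := lgenP p => /gen[s [r [ps e]]].
by apply/(ordn_ge _ (lgenP p)) => //; exists s, r; rewrite expr1.
Qed.

End Krull.

Lemma freegP (T : choiceType) (D E : {freeg T / int}) :
  (forall x, coeff x D = coeff x E) -> D = E.
Proof. by move=> h; apply/eqP/freeg_eqP. Qed.

(** * Orders of fractions, and regularity in codimension one *)

Definition ord (A : idomainType) (p : primeDivisor A) (x : {fraction A}) : int :=
  xget 0 (has_order p x).

Definition regular_at (A : idomainType) (q : Spec A) (x : {fraction A}) : Prop :=
  exists a s, ~ spec_set q s /\ x = tofrac a / tofrac s.

Section Ord.
Variable A : idomainType.
Hypotheses (hN : noetherian A) (hC : completely_integrally_closed A).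
Implicit Types (p : primeDivisor A) (x y : {fraction A}).

Lemma frac_neq0 (a b : A) : b != 0 -> (tofrac a / tofrac b != 0) = (a != 0).
Proof. by move=> b0; rewrite mulf_eq0 invr_eq0 !tofrac_eq0 (negPf b0) orbF. Qed.

Lemma fracW_neq0 x : x != 0 -> exists a b, [/\ a != 0, b != 0 & x = tofrac a / tofrac b].
Proof.
have [a [b [b0 ->]]] := fracW x; rewrite frac_neq0 // => a0; by exists a, b.
Qed.

Lemma ord_has_order p (a b : A) : a != 0 -> b != 0 ->
  has_order p (tofrac a / tofrac b) ((ordn p a)%:Z - (ordn p b)%:Z).
Proof.
move=> a0 b0; exists a, b, (ordn p a), (ordn p b).
by split=> //; exact: ordn_has_order.
Qed.

Lemma ord_frac p (a b : A) : a != 0 -> b != 0 ->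
  ord p (tofrac a / tofrac b) = (ordn p a)%:Z - (ordn p b)%:Z.
Proof.
move=> a0 b0; have h := ord_has_order p a0 b0.
have [a' [b' [k [l [b'0 e /has_order_ordn -> // ]]]]] := xgetI 0 h.
move=> /has_order_ordn -> // h'; rewrite /ord h'.
have e' := (frac_eq a a' b0 b'0).1 e.
have a'0 : a' != 0.
  by apply: contra_neq (mulf_neq0 a0 b'0) => a'0; rewrite e' a'0 mul0r.
have := congr1 (ordn p) e'; rewrite !ordnM //; lia.
Qed.

Lemma ord_tofrac p (a : A) : a != 0 -> ord p (tofrac a) = (ordn p a)%:Z.
Proof.
move=> a0; rewrite -[tofrac a]divr1 -tofrac1 ord_frac ?oner_neq0 //.
by rewrite (ordn_eq0 _ _ (@spec_nmem1 _ p)) // subr0.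
Qed.

Lemma has_orderE p x n : has_order p x n <-> x != 0 /\ ord p x = n.
Proof.
split=> [[a [b [k [l [b0 -> ak bl ->]]]]]|[x0 <-]].
  have a0 := has_order_int_neq0 hN hC ak.
  rewrite frac_neq0 // ord_frac //; split=> //.
  by rewrite (has_order_ordn hN hC ak) (has_order_ordn hN hC bl).
have [a [b [a0 b0 ->]]] := fracW_neq0 x0.
by rewrite ord_frac //; exact: ord_has_order.
Qed.

Lemma principalE (D : Div A) :
  principal D <-> exists2 x, x != 0 & forall p, coeff p D = ord p x.
Proof.
split=> -[x x0 h]; exists x => // p; first by have /has_orderE[] := h p.
by apply/has_orderE.
Qed.

Lemma ordM p x y : x != 0 -> y != 0 -> ord p (x * y) = ord p x + ord p y.
Proof.
move=> /fracW_neq0[a [b [a0 b0 ->]]] /fracW_neq0[c [d [c0 d0 ->]]].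
rewrite mulf_div -!tofracM !ord_frac ?mulf_neq0 // !ordnM //; lia.
Qed.

Lemma ord_one p : ord p 1 = 0.
Proof.
by rewrite -tofrac1 ord_tofrac ?oner_neq0 // ordn_eq0 //; exact: spec_nmem1.
Qed.

Lemma ordV p x : ord p x^-1 = - ord p x.
Proof.
have [->|x0] := eqVneq x 0.
  rewrite invr0; suff -> : ord p 0 = 0 by rewrite oppr0.
  have [[n /has_orderE[]]|h] := pselect (exists n, has_order p 0 n).
    by rewrite eqxx.
  by apply: xgetPN => n hn; apply: h; exists n.
by have := ord_one p; rewrite -(mulVf x0) ordM ?invr_eq0 // => /eqP; rewrite addr_eq0 => /eqP.
Qed.

Lemma ordX p x n : x != 0 -> ord p (x ^+ n) = ord p x *+ n.
Proof.
move=> x0; elim: n => [|n IH]; first by rewrite expr0 ord_one.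
by rewrite exprS ordM ?expf_neq0 // IH mulrS.
Qed.

Lemma regular_at_ord p x : x != 0 -> regular_at p x <-> 0 <= ord p x.
Proof.
move=> x0; split.
  move=> [a [s [ps xE]]]; rewrite xE in x0 *.
  have s0 := spec_nmem_neq0 ps; rewrite frac_neq0 // in x0.
  by rewrite ord_frac // (ordn_eq0 _ _ ps) // subr0.
have [a [b [a0 b0 ->]]] := fracW_neq0 x0; rewrite ord_frac //.
have lt := lgenP hN hC p; have [pt t0 _] := lt.
have [s [u [ps pu e]]] := ordnP hN hC lt a0.
have [s' [u' [ps' pu' e']]] := ordnP hN hC lt b0.
move: (ordn p a) (ordn p b) e e' => n m e e'; rewrite subr_ge0 lez_nat => mn.
(* With [t = lgen p], the equations [s * a = u * t ^+ n] and [s' * b = u' * t ^+ m] give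
   [a / b = u * t ^+ (n - m) * s' / (s * u')]. *)
exists (u * lgen p ^+ (n - m) * s'), (s * u'); split; first exact: spec_nmemM.
apply/frac_eq => //; first by rewrite mulf_neq0 ?(spec_nmem_neq0 ps) ?(spec_nmem_neq0 pu').
move: (spec_nmem_neq0 ps') (spec_nmem_neq0 ps) => s'0 s0.
have -> : a * (s * u') = u' * (s * a) by ring.
rewrite e; have -> : u * lgen p ^+ (n - m) * s' * b = u * lgen p ^+ (n - m) * (s' * b) by ring.
rewrite e'; have -> : lgen p ^+ n = lgen p ^+ (n - m) * lgen p ^+ m by rewrite -exprD subnK.
ring.
Qed.

End Ord.

Section Regular.
Variables (A : idomainType) (q : Spec A).
Implicit Types x y : {fraction A}.

Lemma regular_atD x y : regular_at q x -> regular_at q y -> regular_at q (x + y).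
Proof.
move=> [a [s [qs ->]]] [b [t [qt ->]]].
exists (a * t + b * s), (s * t); split; first exact: spec_nmemM.
by rewrite addf_div ?tofrac_eq0 ?(spec_nmem_neq0 qs) ?(spec_nmem_neq0 qt) // tofracD !tofracM.
Qed.

Lemma regular_atM x y : regular_at q x -> regular_at q y -> regular_at q (x * y).
Proof.
move=> [a [s [qs ->]]] [b [t [qt ->]]].
exists (a * b), (s * t); split; first exact: spec_nmemM.
by rewrite mulf_div !tofracM.
Qed.

Lemma regular_at_tofrac a : regular_at q (tofrac a).
Proof. by exists a, 1; split; [exact: spec_nmem1 | rewrite tofrac1 divr1]. Qed.

Lemma regular_at0 : regular_at q 0.
Proof. by rewrite -tofrac0; exact: regular_at_tofrac. Qed.

Lemma regular_at1 : regular_at q 1.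
Proof. by rewrite -tofrac1; exact: regular_at_tofrac. Qed.

Lemma regular_atN x : regular_at q x -> regular_at q (- x).
Proof.
move=> [a [s [qs ->]]]; exists (- a), s; split=> //; by rewrite tofracN mulNr.
Qed.

Lemma regular_atX x n : regular_at q x -> regular_at q (x ^+ n).
Proof.
move=> qx; elim: n => [|n IH]; first by rewrite expr0; exact: regular_at1.
by rewrite exprS; exact: regular_atM.
Qed.

End Regular.

Section Krull.
Variable A : idomainType.
Hypotheses (hN : noetherian A) (hC : completely_integrally_closed A).
Implicit Types (p : primeDivisor A) (x y : {fraction A}).

(** The localization at [q] is the intersection of the valuation rings of the prime divisors through
    [q]: by [exists_prime_divisor], a fraction not regular at [q] fails to be regular at one of
    them. *)
Lemma krull_local (q : Spec A) x :
  regular_at q x <-> forall p, p `<=` q -> regular_at p x.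
Proof.
split=> [[a [s [qs ->]]] p pq|h]; first by exists a, s; split=> // /pq.
have [a [b [b0 xE]]] := fracW x; rewrite xE in h *; apply: contrapT => nr.
have [|p [pq]] := exists_prime_divisor hN hC (q := q) (a := a) b0.
  move=> [s [r [qs e]]]; apply: nr; exists r, s; split=> //.
  by apply/(frac_eq _ _ b0 (spec_nmem_neq0 qs)); rewrite mulrC.
have [r [s [ps]]] := h p pq => /(frac_eq _ _ b0 (spec_nmem_neq0 ps)) e; apply.
by exists s, r; rewrite mulrC.
Qed.

(** If the ideal [I] of denominators of [x] were proper, it would lie in a prime [q]; but [x] is
    regular at [q] by [krull_local], so it has a denominator outside [q]. *)
Lemma krull x : (forall p, regular_at p x) -> exists a, x = tofrac a.
Proof.
move=> h; have [a [b [b0 xE]]] := fracW x.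
pose I : set A := [set s | exists r, s * a = r * b].
have iI : is_ideal I.
  split; first by exists 0; rewrite !mul0r.
  by move=> z u v [r e] [r' e']; exists (z * r + r');
    apply: (lincomb2 (k := z) (k' := 1) e e'); ring.
have [[c cE]|I1] := pselect (I 1).
  by exists c; rewrite xE -[tofrac c]divr1 -tofrac1; apply/frac_eq; rewrite ?oner_neq0 // -cE mulrC.
have [q Iq] := exists_prime iI I1.
have /krull_local[r [s [qs]]] : forall p, p `<=` q -> regular_at p x by [].
rewrite xE => /(frac_eq _ _ b0 (spec_nmem_neq0 qs)) e.
by case: qs; apply: Iq; exists r; rewrite mulrC.
Qed.

End Krull.

(** * Sections of the structure sheaf as fractions *)

(** Stalks are embedded in a field [K], and sections are compared through their
    values in [K]. *)
Section LocVal.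
Variables (R : comPzRingType) (K : fieldType) (i : {rmorphism R -> K}).
Hypothesis i_inj : injective i.
Variable p : Spec R.

Definition locval (x : loc p) : K := i (loc_num x) / i (loc_den x).

Lemma i_nmem_neq0 s : ~ spec_set p s -> i s != 0.
Proof.
move=> ps; apply/eqP => e; apply: ps; have -> : s = 0 by apply: i_inj; rewrite e rmorph0.
exact: spec0.
Qed.

Lemma locvalE a s (ps : ~ spec_set p s) : locval (mkloc a ps) = i a / i s.
Proof.
have [u pu e] := loc_repr a ps.
apply/eqP; rewrite /locval eqr_div ?i_nmem_neq0 //; last exact: loc_denP.
apply/eqP/(mulfI (i_nmem_neq0 pu)).
by rewrite -!rmorphM e mulrC.
Qed.

Lemma locvalD x y : locval (x + y) = locval x + locval y.
Proof.
have [a [s [ps ->]]] := locW x; have [b [t [pt ->]]] := locW y.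
rewrite -[_ + mkloc _ _]/(loc_add _ _) loc_addE !locvalE addf_div ?i_nmem_neq0 //.
by rewrite rmorphD !rmorphM.
Qed.

Lemma locvalM x y : locval (x * y) = locval x * locval y.
Proof.
have [a [s [ps ->]]] := locW x; have [b [t [pt ->]]] := locW y.
rewrite -[_ * mkloc _ _]/(loc_mul _ _) loc_mulE !locvalE mulf_div //.
by rewrite !rmorphM.
Qed.

Lemma locval1 : locval 1 = 1.
Proof. by rewrite -[1]/(mkloc 1 (@spec_nmem1 _ p)) locvalE rmorph1 divr1. Qed.

Lemma locval0 : locval 0 = 0.
Proof. by rewrite -[0 in LHS]/(mkloc 0 (@spec_nmem1 _ p)) locvalE rmorph0 mul0r. Qed.

Lemma locval_inj : injective locval.
Proof.
move=> x y; have [a [s [ps ->]]] := locW x; have [b [t [pt ->]]] := locW y.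
rewrite !locvalE => /eqP; rewrite eqr_div ?i_nmem_neq0 // -!rmorphM => /eqP /i_inj e.
exact: mkloc_eq.
Qed.

End LocVal.

Section PullSection.
Variable K : fieldType.
Variables (R S : comPzRingType) (i : {rmorphism R -> K}) (j : {rmorphism S -> K}).
Hypotheses (i_inj : injective i) (j_inj : injective j).
Variables (V : set (Spec R)) (W : set (Spec S)) (f : W -> V).
Hypothesis f_cont : forall (O : set (Spec R)) (q : W), open O -> O (set_val (f q)) ->
  exists O' : set (Spec S), [/\ open O', O' (set_val q) &
    forall q' : W, O' (set_val q') -> O (set_val (f q'))].
Hypothesis f_loc : forall (q : W) (x : loc (set_val (f q))),
  exists y : loc (set_val q), locval j y = locval i x.

(** Only the value in [K] is prescribed; by [locval_inj] it determines the chosen germ. *)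
Definition pull_germ (s : sections V) : germs W :=
  fun q => projT1 (cid (f_loc (section_fun s (f q)))).

Lemma pull_germE (s : sections V) q :
  locval j (pull_germ s q) = locval i (section_fun s (f q)).
Proof. exact: (projT2 (cid (f_loc (section_fun s (f q))))). Qed.

Lemma zariski_basic (T : comPzRingType) (g : T) : open [set q : Spec T | ~ spec_set q g].
Proof.
exists [set g]; apply/seteqP; split=> q /= h; first by move=> /(_ g erefl).
by move=> qg; apply: h => _ ->.
Qed.

Lemma pull_regular (s : sections V) : pull_germ s \in regular (V := W).
Proof.
apply/asboolP => q; have /asboolP sP := sectionP s.
have [O [oO Oq [a [b sE]]]] := sP (f q).
have [O' [oO' O'q O'O]] := f_cont oO Oq.
have [c [d [qd e]]] := locW (pull_germ s q).
(* The value in [K] is [a / b] near [f q], and at [q] it is also [c / d]; so [c / d] represents the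
   pulled-back section wherever [d] is invertible. *)
exists (O' `&` [set q : Spec S | ~ spec_set q d]); split.
- by apply: openI => //; exact: zariski_basic.
- by [].
exists c, d => q' [O'q' q'd]; exists q'd; apply: (locval_inj j_inj).
have [qb Eq] := sE _ Oq; have [q'b Eq'] := sE _ (O'O _ O'q').
rewrite pull_germE Eq' locvalE // locvalE //.
have := pull_germE s q; rewrite e Eq locvalE // locvalE //.
Qed.

Definition pull_section (s : sections V) : sections W := MkSections (pull_regular s).

Lemma pull_sectionE (s : sections V) q :
  locval j (section_fun (pull_section s) q) = locval i (section_fun s (f q)).
Proof. exact: pull_germE. Qed.

Lemma section_ext (T : comPzRingType) (U : set (Spec T)) (s t : sections U) :
  (forall q, section_fun s q = section_fun t q) -> s = t.
Proof. by move=> h; apply/val_inj/functional_extensionality_dep. Qed.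

Lemma pull_section_zmod : zmod_morphism pull_section.
Proof.
move=> s t; apply/eqP; rewrite eq_sym subr_eq; apply/eqP/section_ext => q.
apply: (locval_inj j_inj).
rewrite [RHS](_ : _ = locval j (section_fun (pull_section (s - t)) q +
  section_fun (pull_section t) q)) //.
rewrite locvalD // !pull_sectionE -locvalD //.
by rewrite -[in LHS](subrK t s).
Qed.

Lemma pull_section_monoid : monoid_morphism pull_section.
Proof.
split.
  apply/section_ext => q; apply: (locval_inj j_inj); rewrite pull_sectionE.
  by rewrite [LHS](locval1 i_inj) [RHS](locval1 j_inj).
move=> s t; apply/section_ext => q; apply: (locval_inj j_inj).
rewrite pull_sectionE [RHS](locvalM j_inj) !pull_sectionE.
exact: (locvalM i_inj).
Qed.

Definition pull_rmorphism : {rmorphism sections V -> sections W} :=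
  HB.pack pull_section
    (GRing.isZmodMorphism.Build _ _ pull_section pull_section_zmod)
    (GRing.isMonoidMorphism.Build _ _ pull_section pull_section_monoid).

End PullSection.

(** * The affineness criterion *)

(** The ideal generated by the equations of the complement of [U] in the ring of
    regular functions on [U]. *)
Definition affine_span (A : idomainType) (U : set (Spec A)) : set {fraction A} :=
  [set y | exists s : seq (A * {fraction A}),
    (forall z, z \in s -> (forall q, ~ spec_set q z.1 -> U q) /\
                          (forall q, U q -> regular_at q z.2)) /\
    y = \sum_(z <- s) tofrac z.1 * z.2].

Lemma affine_spanW (A : idomainType) (U : set (Spec A)) y : affine_span U y ->
  exists n (a : 'I_n -> A) (b : 'I_n -> {fraction A}),
  [/\ forall i q, ~ spec_set q (a i) -> U q, forall i q, U q -> regular_at q (b i)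
    & y = \sum_i tofrac (a i) * b i].
Proof.
move=> [s [sU ->]]; exists (size s), (fun i => (nth (0, 0) s i).1), (fun i => (nth (0, 0) s i).2).
split=> [i|i|]; [exact: (sU _ (mem_nth _ (ltn_ord i))).1 |
  exact: (sU _ (mem_nth _ (ltn_ord i))).2 | by rewrite (big_nth (0, 0)) big_mkord].
Qed.

Section AffineSpan.
Variables (A : idomainType) (U : set (Spec A)).

Lemma affine_span0 : affine_span U 0.
Proof. by exists [::]; rewrite big_nil. Qed.

Lemma affine_spanD x y : affine_span U x -> affine_span U y -> affine_span U (x + y).
Proof.
move=> [s [sU ->]] [t [tU ->]]; exists (s ++ t); rewrite big_cat; split=> // z.
by rewrite mem_cat => /orP[/sU|/tU].
Qed.

Lemma affine_spanM x y : (forall q, U q -> regular_at q x) -> affine_span U y ->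
  affine_span U (x * y).
Proof.
move=> xU [s [sU ->]]; exists [seq (z.1, x * z.2) | z <- s]; split.
  move=> _ /mapP[z /sU[z1 z2] ->]; split=> // q Uq; apply: regular_atM; [exact: xU | exact: z2].
by rewrite big_map big_distrr /=; apply: eq_bigr => z _; rewrite mulrCA.
Qed.

Lemma affine_span_gen a : (forall q, ~ spec_set q a -> U q) -> affine_span U (tofrac a).
Proof.
move=> aU; exists [:: (a, 1)]; rewrite big_seq1 mulr1; split=> // z.
by rewrite inE => /eqP->; split=> // q _; exact: regular_at1.
Qed.

End AffineSpan.

Definition affine_criterion (A : idomainType) (U : set (Spec A)) : Prop := affine_span U 1.

(** * The ring of regular functions on an open set and its spectrum *)

Section RegularFunctions.
Variables (A : idomainType) (U : set (Spec A)).

Definition regular_on : pred {fraction A} := fun x => `[< forall q, U q -> regular_at q x >].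

Lemma regular_on_subring : subring_closed regular_on.
Proof.
split=> [|x y /asboolP xr /asboolP yr|x y /asboolP xr /asboolP yr]; apply/asboolP => q Uq.
- exact: regular_at1.
- by apply: regular_atD; [exact: xr | apply: regular_atN; exact: yr].
- by apply: regular_atM; [exact: xr | exact: yr].
Qed.

Record regfun := MkRegfun { regval :> {fraction A}; regvalP : regval \in regular_on }.

HB.instance Definition _ := [isSub for regval].
HB.instance Definition _ := [Choice of regfun by <:].
HB.instance Definition _ :=
  GRing.SubChoice_isSubComPzRing.Build {fraction A} regular_on regfun regular_on_subring.

Lemma regval_zmod : zmod_morphism regval. Proof. exact: raddfB (val : regfun -> _). Qed.
Lemma regval_monoid : monoid_morphism regval.
Proof.
by split=> [|x y]; [exact: (rmorph1 (val : regfun -> _)) |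
  exact: (rmorphM (val : regfun -> _))].
Qed.
HB.instance Definition _ := GRing.isZmodMorphism.Build _ _ regval regval_zmod.
HB.instance Definition _ := GRing.isMonoidMorphism.Build _ _ regval regval_monoid.

Lemma regvalD (x y : regfun) : regval (x + y) = regval x + regval y.
Proof. exact: rmorphD. Qed.
Lemma regvalM (x y : regfun) : regval (x * y) = regval x * regval y.
Proof. exact: rmorphM. Qed.
Lemma regval1 : regval 1 = 1. Proof. exact: rmorph1. Qed.
Lemma regval0 : regval 0 = 0. Proof. exact: rmorph0. Qed.

Lemma regval_inj : injective regval. Proof. exact: val_inj. Qed.

Lemma regvalW (x : regfun) q : U q -> regular_at q (regval x).
Proof. by have /asboolP := regvalP x; apply. Qed.

Lemma regfun_const_subproof (a : A) : tofrac a \in regular_on.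
Proof. by apply/asboolP => q _; exact: regular_at_tofrac. Qed.

Definition regfun_const (a : A) : regfun := MkRegfun (regfun_const_subproof a).

Lemma regfun_constD a b : regfun_const (a + b) = regfun_const a + regfun_const b.
Proof. by apply: val_inj; rewrite rmorphD /= tofracD. Qed.
Lemma regfun_constM a b : regfun_const (a * b) = regfun_const a * regfun_const b.
Proof. by apply: val_inj; rewrite rmorphM /= tofracM. Qed.
Lemma regfun_const0 : regfun_const 0 = 0.
Proof. by apply: val_inj; rewrite rmorph0 /= tofrac0. Qed.
Lemma regfun_const1 : regfun_const 1 = 1.
Proof. by apply: val_inj; rewrite rmorph1 /= tofrac1. Qed.

(** The contraction to the regular functions of the maximal ideal of the localization at [q], when
    [q] is in [U]. *)
Definition vanish_at (q : Spec A) : set regfun :=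
  [set x | exists a s, [/\ spec_set q a, ~ spec_set q s & regval x = tofrac a / tofrac s]].

Lemma vanish_frac (q : Spec A) (x : regfun) a s : ~ spec_set q s ->
  regval x = tofrac a / tofrac s -> vanish_at q x <-> spec_set q a.
Proof.
move=> qs xE; split=> [[b [t [qb qt]]]|qa]; last by exists a, s.
rewrite xE => /(frac_eq _ _ (spec_nmem_neq0 qs) (spec_nmem_neq0 qt)) e.
apply: contrapT => qa; apply: (spec_nmemM qa qt); rewrite e; exact: specMr.
Qed.

Lemma vanish_prime q : U q -> is_prime (vanish_at q).
Proof.
move=> Uq; split.
- split.
    exists 0, 1; rewrite regval0 tofrac0 mul0r.
    by split=> //; [exact: spec0 | exact: spec_nmem1].
  move=> x y z [a [s [qa qs ya]]] [b [t [qb qt zb]]].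
  have [c [u [qu xc]]] := regvalW x Uq.
  exists (c * a * t + b * (u * s)), (u * s * t); split.
  + by apply: specD; [apply: specMr; exact: specMl | exact: specMr].
  + by apply: spec_nmemM => //; exact: spec_nmemM.
  have [u0 s0] := (spec_nmem_neq0 qu, spec_nmem_neq0 qs).
  rewrite regvalD regvalM xc ya zb mulf_div addf_div ?mulf_neq0 ?tofrac_eq0 //;
    last exact: spec_nmem_neq0 qt.
  by rewrite tofracD !tofracM.
- move=> /(vanish_frac (a := 1) (@spec_nmem1 _ q)); rewrite regval1 tofrac1 divr1.
  by move=> /(_ erefl); exact: spec_nmem1.
move=> x y; have [a [s [qs xE]]] := regvalW x Uq; have [b [t [qt yE]]] := regvalW y Uq.
have xyE : regval (x * y) = tofrac (a * b) / tofrac (s * t).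
  by rewrite regvalM xE yE mulf_div !tofracM.
move=> /(vanish_frac (spec_nmemM qs qt) xyE); have [_ _ qP] := spec_prime q.
by case/qP => [/(vanish_frac qs xE)|/(vanish_frac qt yE)]; [left | right].
Qed.

Lemma contract_prime (P : Spec regfun) :
  is_prime [set a | spec_set P (regfun_const a)].
Proof.
split=> /=.
- split=> /=; first by rewrite regfun_const0; exact: spec0.
  move=> a x y Px Py; rewrite regfun_constD regfun_constM.
  by apply: specD => //; exact: specMl.
- by rewrite regfun_const1; exact: spec_nmem1.
by move=> x y; rewrite regfun_constM; have [_ _] := spec_prime P; apply.
Qed.

Definition contract (P : Spec regfun) : Spec A := MkSpec (contract_prime P).

Hypothesis hU : affine_criterion U.

(** Here the criterion enters: as [1 = \sum_i a i * b i], some [a i] lies outside [P], and the basic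
    open set of [a i] is contained in [U]. *)
Lemma contractU (P : Spec regfun) : U (contract P).
Proof.
have [n [a [b [aU bU ab1]]]] := affine_spanW hU.
have bP i : b i \in regular_on by apply/asboolP => q /(bU i).
have [i Pai] : exists i, ~ spec_set P (regfun_const (a i)).
  apply: contrapT => /forallNP h; apply: (@spec_nmem1 _ P).
  have -> : (1 : regfun) = \sum_i regfun_const (a i) * MkRegfun (bP i).
    apply: val_inj; rewrite rmorph1 rmorph_sum [LHS]ab1; apply: eq_bigr => i _.
    by rewrite rmorphM.
  by apply: spec_sum => i _; apply: specMr; apply: contrapT; exact: h.
by apply: (aU i).
Qed.

Definition to_spec (q : U) : Spec regfun := MkSpec (vanish_prime (set_valP q)).
Definition of_spec (P : Spec regfun) : U := exist _ (contract P) (mem_set (contractU P)).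

Lemma to_specK : cancel to_spec of_spec.
Proof.
move=> q; apply: val_inj; apply: spec_inj => a /=.
  by move/(vanish_frac (a := a) (@spec_nmem1 _ (set_val q))); apply; rewrite tofrac1 divr1.
move=> qa; apply/(vanish_frac (a := a) (@spec_nmem1 _ (set_val q))) => //.
by rewrite tofrac1 divr1.
Qed.

Lemma contract_frac (P : Spec regfun) (x : regfun) a s : ~ spec_set (contract P) s ->
  regval x = tofrac a / tofrac s -> spec_set P x <-> spec_set (contract P) a.
Proof.
move=> /= Ps xE.
have e : x * regfun_const s = regfun_const a.
  apply: regval_inj; rewrite regvalM xE /= mulfVK // tofrac_eq0.
  exact: (spec_nmem_neq0 (p := contract P)).
rewrite -e; split; first exact: specMr.
by have [_ _ PP] := spec_prime P => /PP[].
Qed.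

Lemma of_specK : cancel of_spec to_spec.
Proof.
move=> P; have UP := contractU P; apply: spec_inj => x /=;
  have [a [s [Ps xE]]] := regvalW x UP.
  by move=> /(vanish_frac Ps xE) ?; apply/(contract_frac Ps xE).
by move=> /(contract_frac Ps xE) ?; apply/(vanish_frac Ps xE).
Qed.

End RegularFunctions.

Lemma subtype_openP (X : topologicalType) (U : set X) (O : set U) :
  open O <-> exists2 B : set X, open B & set_val @^-1` B = O.
Proof. by []. Qed.

Section CriterionAffine.
Variables (A : idomainType) (U : set (Spec A)).
Hypothesis hU : affine_criterion U.

Let h := @to_spec A U.
Let g := of_spec hU.

Lemma to_spec_open (O : set (Spec (regfun U))) : open O ->
  exists O' : set (Spec A), open O' /\
    forall q : U, O (h q) <-> O' (set_val q).
Proof.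
(* A regular function [x] does not vanish at a point of [U] exactly if [a * s] is outside the point
   for some representation [x = a / s]; hence all representations are collected. *)
move=> [S ->]; exists [set q : Spec A | ~ ([set z | exists (x : regfun U) a s,
    [/\ S x, s != 0, regval x = tofrac a / tofrac s & z = a * s]] `<=` q)].
split; first by exists [set z | exists (x : regfun U) a s,
    [/\ S x, s != 0, regval x = tofrac a / tofrac s & z = a * s]].
move=> q; split=> /= hS sub; apply: hS.
  move=> x Sx /=; have [a [s [qs xE]]] := regvalW x (set_valP q).
  apply/(vanish_frac qs xE); have : spec_set (set_val q) (a * s).
    by apply: sub; exists x, a, s; rewrite (spec_nmem_neq0 qs).
  by have [_ _ qP] := spec_prime (set_val q) => /qP[].
move=> _ [x [a [s [Sx s0 xE ->]]]].
have /= [b [t [qb qt xE']]] := sub _ Sx.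
have [qs|qs] := pselect (spec_set (set_val q) s); first exact: specMl.
by apply: specMr; apply/(vanish_frac qs xE); exists b, t.
Qed.

Lemma to_spec_continuous : continuous h.
Proof.
apply/continuousP => O /to_spec_open[O' [oO' e]].
apply/subtype_openP; exists O' => //.
by apply/seteqP; split=> q /= /e.
Qed.

Lemma contract_open (O : set (Spec A)) : open O ->
  open [set P : Spec (regfun U) | O (contract P)].
Proof.
move=> [S ->]; exists (regfun_const U @` S); apply/seteqP; split=> P /= hS sub; apply: hS.
  by move=> a Sa /=; apply: sub; exists a.
by move=> _ [a Sa <-]; exact: sub.
Qed.

Lemma of_spec_continuous : continuous g.
Proof.
apply/continuousP => O /subtype_openP[B oB <-]; exact: contract_open.
Qed.

Section OnOpen.
Variable V : set (Spec (regfun U)).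
Let W := set_val @` (h @^-1` V).

Lemma preimage_point (q : W) : exists u : U, V (h u) /\ set_val u = set_val q.
Proof. by have [u Vu e] := set_valP q; exists u. Qed.

(** Points of [W] come without a preimage in [U], so one is chosen; [fwdE] records what is used of
    the choice. *)
Definition fwd (q : W) : V :=
  exist _ (h (projT1 (cid (preimage_point q))))
    (mem_set (proj1 (projT2 (cid (preimage_point q))))).

Lemma fwdE (q : W) : exists u : U, set_val (fwd q) = h u /\ set_val u = set_val q.
Proof.
exists (projT1 (cid (preimage_point q))); split=> //.
exact: (proj2 (projT2 (cid (preimage_point q)))).
Qed.

Lemma bwd_subproof (P : V) : W (contract (set_val P)).
Proof.
exists (g (set_val P)) => //=; rewrite /g /h of_specK; exact: set_valP.
Qed.

Definition bwd (P : V) : W := exist _ (contract (set_val P)) (mem_set (bwd_subproof P)).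

Lemma fwdK : cancel fwd bwd.
Proof.
move=> q; have [u [e e']] := fwdE q; apply: val_inj => /=.
rewrite e; transitivity (set_val u) => //; exact: (congr1 set_val (to_specK hU u)).
Qed.

Lemma bwdK : cancel bwd fwd.
Proof.
move=> P; have [u [e e']] := fwdE (bwd P); apply: val_inj => /=.
rewrite -[RHS](of_specK hU); rewrite -[LHS]/(set_val (fwd (bwd P))) e.
by congr to_spec; apply: val_inj; rewrite [LHS]e'.
Qed.

Lemma fwd_cont (O : set (Spec (regfun U))) (q : W) : open O -> O (set_val (fwd q)) ->
  exists O' : set (Spec A), [/\ open O', O' (set_val q) &
    forall q' : W, O' (set_val q') -> O (set_val (fwd q'))].
Proof.
move=> /to_spec_open[O' [oO' e]]; have [u [qu uq]] := fwdE q.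
rewrite qu => /e; rewrite uq => O'q; exists O'; split=> // q'.
by have [u' [qu' uq']] := fwdE q'; rewrite qu' -uq' => /e.
Qed.

Lemma bwd_cont (O : set (Spec A)) (P : V) : open O -> O (set_val (bwd P)) ->
  exists O' : set (Spec (regfun U)), [/\ open O', O' (set_val P) &
    forall P' : V, O' (set_val P') -> O (set_val (bwd P'))].
Proof.
by move=> oO OP; exists [set P | O (contract P)]; split=> //; exact: contract_open.
Qed.

Lemma fwd_loc (q : W) (x : loc (set_val (fwd q))) :
  exists y : loc (set_val q), locval (@tofrac A) y = locval (@regval A U) x.
Proof.
have [u [qu uq]] := fwdE q; move: x; rewrite qu => x.
have [b [d [ud ->]]] := locW x; rewrite -uq.
have [b1 [b2 [ub2 bE]]] := regvalW b (set_valP u).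
have [d1 [d2 [ud2 dE]]] := regvalW d (set_valP u).
have ud1 : ~ spec_set (set_val u) d1 by move=> /(vanish_frac ud2 dE).
exists (mkloc (b1 * d2) (spec_nmemM ub2 ud1)); rewrite !locvalE; last 2 first.
- exact: regval_inj.
- exact: tofrac_inj.
by rewrite /= bE dE invf_div mulf_div !tofracM.
Qed.

Lemma bwd_loc (P : V) (x : loc (set_val (bwd P))) :
  exists y : loc (set_val P), locval (@regval A U) y = locval (@tofrac A) x.
Proof.
have [a [s [Ps ->]]] := locW x.
have Ps' : ~ spec_set (set_val P) (regfun_const U s) by [].
exists (mkloc (regfun_const U a) Ps'); rewrite !locvalE //.
- exact: tofrac_inj.
- exact: regval_inj.
Qed.

Definition sheaf_fwd : {rmorphism sections V -> sections W} :=
  pull_rmorphism (@regval_inj A U) (@tofrac_inj A) fwd_cont fwd_loc.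

Definition sheaf_bwd : {rmorphism sections W -> sections V} :=
  pull_rmorphism (@tofrac_inj A) (@regval_inj A U) bwd_cont bwd_loc.

Lemma sheaf_fwdE (s : sections V) (q : W) :
  locval (@tofrac A) (section_fun (sheaf_fwd s) q) = locval (@regval A U) (section_fun s (fwd q)).
Proof. exact: pull_sectionE. Qed.

Lemma sheaf_fwd_bij : bijective sheaf_fwd.
Proof.
exists sheaf_bwd => s; apply: section_ext => q.
  apply: (locval_inj (@regval_inj A U)).
  by rewrite pull_sectionE pull_sectionE bwdK.
apply: (locval_inj (@tofrac_inj A)).
by rewrite pull_sectionE pull_sectionE fwdK.
Qed.

End OnOpen.

(** The coordinate ring is [regfun U]. Sections are compared by their values in the fraction field,
    on which restriction has no effect. *)
Theorem criterion_affine : affine_open U.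
Proof.
exists (regfun U), h, g, (fun V _ => sheaf_fwd V); split.
- exact: to_spec_continuous.
- exact: of_spec_continuous.
- exact: to_specK.
- exact: of_specK.
split=> [V oV|V W oV oW VW s]; first exact: sheaf_fwd_bij.
apply: section_ext => q; apply: (locval_inj (@tofrac_inj A)).
apply: (etrans (sheaf_fwdE _ _)).
apply: (etrans _ (esym (sheaf_fwdE s (widen (Defs.image_preimage_subset (h := h) VW) q)))).
have [u [e uq]] := fwdE q.
have [u' [e' uq']] := fwdE (widen (Defs.image_preimage_subset (h := h) VW) q).
have -> : fwd (widen (Defs.image_preimage_subset (h := h) VW) q) = widen VW (fwd q).
  apply: val_inj; rewrite /= [LHS]e' [RHS]e; congr to_spec.
  by apply: val_inj; rewrite [LHS]uq' [RHS]uq.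
by [].
Qed.

End CriterionAffine.

(** * From affineness to the criterion *)

Section FracSection.
Variables (R : comPzRingType) (V : set (Spec R)).

Definition frac_germ (a s : R) (Vs : forall q, V q -> ~ spec_set q s) : germs V :=
  fun q => mkloc a (Vs _ (set_valP q)).

Lemma frac_regular a s Vs : @frac_germ a s Vs \in regular (V := V).
Proof.
apply/asboolP => p; exists setT; split=> //; first exact: openT.
by exists a, s => q _; exists (Vs _ (set_valP q)).
Qed.

Definition frac_section a s Vs : sections V := MkSections (@frac_regular a s Vs).

Definition const_section a : sections V := frac_section a (fun q _ => @spec_nmem1 _ q).

Lemma const_sectionD a b : const_section (a + b) = const_section a + const_section b.
Proof.
apply: section_ext => q; apply: (etrans _ (esym (loc_addE _ _ _ _))).
by apply: mkloc_eq; ring.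
Qed.

Lemma const_sectionM a b : const_section (a * b) = const_section a * const_section b.
Proof.
apply: section_ext => q; apply: (etrans _ (esym (loc_mulE _ _ _ _))).
by apply: mkloc_eq; ring.
Qed.

Lemma const_section0 : const_section 0 = 0.
Proof. exact: section_ext. Qed.

Lemma const_section1 : const_section 1 = 1.
Proof. exact: section_ext. Qed.

End FracSection.

Lemma section_subE (T : comPzRingType) (U : set (Spec T)) (s t : sections U) q :
  section_fun (s - t) q = section_fun s q - section_fun t q.
Proof. by []. Qed.

Section GenericValue.
Variable A : idomainType.

Lemma zero_prime : is_prime [set 0 : A].
Proof.
split=> /=; first by split=> //= a x y -> ->; rewrite mulr0 addr0.
  by move/eqP; rewrite oner_eq0.
by move=> x y /eqP; rewrite mulf_eq0 => /orP[] /eqP; [left | right].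
Qed.

Definition generic_point : Spec A := MkSpec zero_prime.

Lemma open_generic (U : set (Spec A)) q : open U -> U q -> U generic_point.
Proof.
move=> [S ->] /= Sq S0; apply: Sq => x /S0 ->; exact: spec0.
Qed.

Variable V : set (Spec A).
Hypothesis Vg : V generic_point.

(** A neighbourhood on which the section is a single fraction contains the generic point, so each
    value equals the one there. *)
Lemma section_const (s : sections V) (p q : V) :
  locval (@tofrac A) (section_fun s p) = locval (@tofrac A) (section_fun s q).
Proof.
pose e : V := exist _ generic_point (mem_set Vg).
suff H r : locval (@tofrac A) (section_fun s r) = locval (@tofrac A) (section_fun s e).
  by rewrite !H.
have /asboolP sP := sectionP s; have [O [oO Or [a [f sE]]]] := sP r.
have [rf ->] := sE _ Or; have [|ef ->] := sE e; first exact: open_generic Or.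
by rewrite !locvalE //; exact: tofrac_inj.
Qed.

End GenericValue.

Section AffineCriterion.
Variables (A : idomainType) (U : set (Spec A)).
Hypotheses (oU : open U) (Un0 : U !=set0) (aU : affine_open U).

(** [chi] is the value in the fraction field of a global section on the spectrum of [B]. If 1 were
    not in the span, the elements of [B] with value in the span would lie in a prime [q]. Choose [a]
    with basic open set inside [U] and containing [g q]. The corresponding section [s] is [b / f]
    near [q]; the value of [b] is a multiple of [a], so [b] is in [q], although [s] is invertible
    near [q]. *)
Theorem affine_open_criterion : affine_criterion U.
Proof.
have Ug : U (generic_point A) by have [q Uq] := Un0; exact: open_generic Uq.
have [B [h [g [phi [h_cont g_cont hK gK [phi_bij phi_nat]]]]]] := aU.
pose T : set (Spec B) := setT.
have oT : open T by exact: openT.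
pose U' : set (Spec A) := set_val @` (h @^-1` T).
have UU' q : U q -> U' q by move=> Uq; exists (exist _ q (mem_set Uq)).
pose eta : U' := exist _ (generic_point A) (mem_set (UU' _ Ug)).
pose chi (s : sections T) := locval (@tofrac A) (section_fun (phi T oT s) eta).
have tI := @tofrac_inj A.
have chiD s t : chi (s + t) = chi s + chi t by rewrite /chi rmorphD; exact: locvalD.
have chiM s t : chi (s * t) = chi s * chi t by rewrite /chi rmorphM; exact: locvalM.
have chi0 : chi 0 = 0 by apply: (addrI (chi 0)); rewrite -chiD !addr0.
have chiB s t : chi (s - t) = chi s - chi t.
  by apply/eqP; rewrite eq_sym subr_eq -chiD subrK.
have chi1 : chi 1 = 1 by rewrite /chi rmorph1; exact: locval1.
have chi_reg s q : U q -> regular_at q (chi s).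
  move=> Uq; pose q' : U' := exist _ q (mem_set (UU' _ Uq)).
  rewrite /chi (section_const (UU' _ Ug) _ eta q').
  have [a [f [qf ->]]] := locW (section_fun (phi T oT s) q').
  by exists a, f; rewrite locvalE.
pose psi (b : B) := chi (const_section T b).
apply: contrapT => nspan.
pose J : set B := [set b | affine_span U (psi b)].
have iJ : is_ideal J.
  split; first by rewrite /J /= /psi const_section0 chi0; exact: affine_span0.
  move=> a x y Jx Jy; rewrite /J /= /psi const_sectionD const_sectionM chiD chiM.
  by apply: affine_spanD => //; apply: affine_spanM => // q; exact: chi_reg.
have [|q Jq] := exists_prime iJ; first by rewrite /J /= /psi const_section1 chi1.
have [S US] := oU.
have US' p : U p = ~ (S `<=` p) by rewrite US.
have Ugq : U (set_val (g q)) := set_valP (g q).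
have [a [Sa ga]] : exists a, S a /\ ~ spec_set (set_val (g q)) a.
  have := Ugq; rewrite US' => /existsNP[a /not_implyP[Sa ga]]; by exists a.
have DaU p : ~ spec_set p a -> U p by move=> pa; rewrite US' => Sp; apply: pa; exact: Sp.
have [phiT' phiTK phiT'K] := phi_bij T oT.
pose alpha : sections U' := const_section U' a.
pose s := phiT' alpha.
have sE : chi s = tofrac a.
  rewrite /chi /s phiT'K /= locvalE //; by rewrite rmorph1 divr1.
pose qT : T := exist _ q (mem_set I).
have /asboolP sP := sectionP s; have [O [oO Oq [b [f sO]]]] := sP qT.
have restrict0 (V W : set (Spec B)) (VW : V `<=` W) (t : sections W) :
    (forall r : V, section_fun t (widen VW r) = 0) -> Defs.restrict VW t = 0.
  by move=> t0; apply: section_ext => r; exact: t0.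
have OT : O `<=` T by [].
(* The equation [f * s = b] holds over [O] only, but by [section_const] the value in the fraction
   field may be read at [g q], which corresponds to a point of [O]. *)
have e : psi f * chi s = psi b.
  pose z := const_section T f * s - const_section T b.
  suff chiz : chi z = 0.
    by apply/eqP; rewrite -subr_eq0 -chiM -chiB; apply/eqP.
  pose zO := Defs.restrict OT z.
  have zO0 : zO = 0.
    apply: restrict0 => r.
    have [rf sr] := sO (widen OT r) (set_valP r).
    rewrite section_subE; apply/eqP; rewrite subr_eq0; apply/eqP.
    apply: (etrans (y := loc_mul (mkloc f (@spec_nmem1 _ (set_val r))) (mkloc b rf))).
      by congr loc_mul; exact: sr.
    by rewrite loc_mulE; apply: mkloc_eq; ring.
  have := phi_nat O T oO oT OT z; rewrite -/zO zO0 rmorph0 => e0.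
  have gqO : (set_val @` (h @^-1` O)) (set_val (g q)).
    by exists (g q) => //=; rewrite gK.
  pose r : set_val @` (h @^-1` O) := exist _ (set_val (g q)) (mem_set gqO).
  have := congr1 (fun t : sections (set_val @` (h @^-1` O)) => section_fun t r) e0.
  rewrite /chi (section_const (UU' _ Ug) _ eta (widen (Defs.image_preimage_subset (h := h) OT) r)).
  move=> /= <-.
  exact: locval0.
have qb : spec_set q b.
  apply: Jq; rewrite /J /= -e sE; apply: affine_spanM; last exact: affine_span_gen.
  move=> p; exact: chi_reg.
(* Invertibility of [s] near [q] is transported from that of [a]: the section [1 / a] over the set
   corresponding to [O2] is pulled through [phi]. *)
pose O2 : set (Spec B) := [set P | ~ spec_set (set_val (g P)) a].
have oO2 : open O2.
  have /continuousP := g_cont.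
  move=> /(_ (set_val @^-1` [set p : Spec A | ~ spec_set p a])); apply.
  by exists [set p : Spec A | ~ spec_set p a] => //; exact: zariski_basic.
have O2T : O2 `<=` T by [].
pose W2 : set (Spec A) := set_val @` (h @^-1` O2).
have W2a p : W2 p -> ~ spec_set p a.
  by move=> [u /= + <-]; rewrite /O2 /= hK.
have [phi2' phi2K phi2'K] := phi_bij O2 oO2.
pose beta : sections W2 := frac_section 1 W2a.
have s_inv : Defs.restrict O2T s * phi2' beta = 1.
  apply: (can_inj phi2K); rewrite rmorphM rmorph1 phi2'K phi_nat.
  rewrite /s phiT'K; apply: section_ext => r.
  apply: (etrans (y := loc_mul (mkloc a (@spec_nmem1 _ (set_val r)))
    (mkloc 1 (W2a _ (set_valP r))))) => //.
  by rewrite loc_mulE -[RHS]/(mkloc 1 (@spec_nmem1 _ _)); apply: mkloc_eq; ring.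
have O2q : O2 q by [].
pose q2 : O2 := exist _ q (mem_set O2q).
have [qf2 sq2] := sO (widen O2T q2) Oq.
have : loc_mul (section_fun s (widen O2T q2)) (section_fun (phi2' beta) q2) = 1.
  exact: (congr1 (fun t : sections O2 => section_fun t q2) s_inv).
rewrite sq2; have [c [d [qd ->]]] := locW (section_fun (phi2' beta) q2).
rewrite loc_mulE => /mkloc_eqP[u qu]; rewrite mulr1 mul1r => E.
apply: (spec_nmemM qu (spec_nmemM qf2 qd)); rewrite -E.
by apply: specMl; exact: specMr.
Qed.

End AffineCriterion.

(** * Divisors *)

Section Complement.
Variable A : idomainType.
Implicit Types (p : primeDivisor A) (D E : Div A).

Lemma complement_open E : open (complement E).
Proof.
suff H (s : seq (primeDivisor A)) :
    open [set q : Spec A | forall p, p \in s -> ~ (p `<=` q)].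
  have -> : complement E = [set q | forall p, p \in dom E -> ~ (p `<=` q)].
    by apply/seteqP; split=> q h p; have := h p; rewrite mem_dom.
  exact: H.
elim: s => [|p s IH].
  by rewrite (_ : mkset _ = setT); [exact: openT | apply/seteqP; split].
rewrite (_ : mkset _ = [set q : Spec A | ~ (p `<=` q)] `&`
    [set q : Spec A | forall p, p \in s -> ~ (p `<=` q)]).
  by apply: openI => //; exists p.
apply/seteqP; split=> q /=.
  by move=> h; split=> [|r rs]; apply: h; rewrite inE ?eqxx // rs orbT.
by move=> [h h'] r; rewrite inE => /predU1P[->//|]; exact: h'.
Qed.

Lemma complement_generic E : complement E (generic_point A).
Proof.
move=> p _ p0; have [[x px x0] _] := pd_height p.
by have := p0 _ px => /= /eqP; rewrite (negPf x0).
Qed.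

Lemma affine_complementE E : affine_open (complement E) <-> affine_span (complement E) 1.
Proof.
split; last exact: criterion_affine.
apply: affine_open_criterion; first exact: complement_open.
by exists (generic_point A); exact: complement_generic.
Qed.

Lemma basic_sub_complement E a :
  (forall q, ~ spec_set q a -> complement E q) <->
  (forall p, coeff p E != 0 -> spec_set p a).
Proof.
split=> h p; first by move=> pE; apply: contrapT => /h /(_ p pE); exact.
by move=> pa r rE rp; apply: pa; apply: rp; exact: h.
Qed.

Hypotheses (hN : noetherian A) (hC : completely_integrally_closed A).

(** A prime divisor outside the support of [E] is itself a point of the complement, and a point of
    the complement lies only on such prime divisors, so [krull_local] applies. *)
Lemma regular_complement E x :
  (forall q, complement E q -> regular_at q x) <->
  (forall p, coeff p E = 0 -> regular_at p x).
Proof.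
split=> h p pE.
  apply: h => r rE /primeDivisor_sub e; by rewrite e pE eqxx in rE.
apply/(krull_local hN hC) => r rp; apply: h; apply/eqP; apply: contrapT => /negP rE.
exact: pE rE rp.
Qed.

(** Finiteness of the support: a prime divisor at which [a / b] has non-zero order contains [a * b],
    hence one of finitely many primes over it, and by height one equals that prime. *)
Lemma exists_div x : x != 0 -> exists D, forall p, coeff p D = ord p x.
Proof.
move=> /fracW_neq0[a [b [a0 b0 xE]]].
pose I : set A := [set z | exists r, z = r * (a * b)].
have iI : is_ideal I.
  split; first by exists 0; rewrite mul0r.
  by move=> z _ _ [r ->] [r' ->]; exists (z * r + r'); ring.
have [s sP] := finite_primes hN iI.
have [t tP] : exists t : seq (primeDivisor A), forall p, pd_point p \in s -> p \in t.
  elim: s {sP} => [|q s [t IH]]; first by exists [::].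
  have [hq|hq] := pselect (height_one q).
    exists (MkPrimeDivisor hq :: t) => p; rewrite !inE => /orP[/eqP e|/IH ->]; last by rewrite orbT.
    by apply/orP; left; apply/eqP; apply: primeDivisor_inj; rewrite /= e.
  exists t => p; rewrite inE => /predU1P[e|]; last exact: IH.
  by case: hq; rewrite -e; exact: pd_height.
exists (\sum_(p <- undup t) << ord p x *g p >>) => p.
rewrite raddf_sum /=.
have [pt|pt] := boolP (p \in undup t).
  rewrite (bigD1_seq p) ?undup_uniq //= coeffU eqxx mulr1 big1 ?addr0 // => r rp.
  by rewrite coeffU (negPf rp) mulr0.
rewrite big_seq big1 => [|r rt]; last first.
  by rewrite coeffU; case: eqP => [e|_]; rewrite ?mulr0 //; rewrite e (negPf pt) in rt.
suff : ~ spec_set p a /\ ~ spec_set p b.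
  by move=> [pa pb]; rewrite xE ord_frac // !ordn_eq0.
rewrite mem_undup in pt.
have pab : ~ spec_set p (a * b).
  move=> pab; have [|q qs [Iq qp]] := sP p.
    by move=> _ [r ->]; exact: specMl.
  have [_ /(_ q qp)[q0|pq]] := pd_height p.
    have /q0 /= /eqP : spec_set q (a * b) by apply: Iq; exists 1; rewrite mul1r.
    by rewrite mulf_eq0 (negPf a0) (negPf b0).
  by move/negP: pt; apply; apply: tP; rewrite (spec_inj pq qp).
by split=> h; apply: pab; [exact: specMr | exact: specMl].
Qed.

(** A product of powers of non-zero elements, one from each prime divisor in the support. *)
Lemma exists_denominator D : exists d : A, d != 0 /\ forall p, coeff p D <= (ordn p d)%:Z.
Proof.
have H (s : seq (primeDivisor A)) : exists d : A, d != 0 /\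
    forall p, p \in s -> coeff p D <= (ordn p d)%:Z.
  elim: s => [|p s [d [d0 dP]]]; first by exists 1; rewrite oner_neq0.
  have [[x px x0] _] := pd_height p.
  exists (d * x ^+ `|coeff p D|%N); split; first by rewrite mulf_neq0 ?expf_neq0.
  have ordnX r n : ordn r (x ^+ n) = (ordn r x * n)%N.
    elim: n => [|n IH]; first by rewrite expr0 muln0 ordn_eq0 //; exact: spec_nmem1.
    by rewrite exprS ordnM ?expf_neq0 // IH mulnS.
  have xp : (0 < ordn p x)%N by apply/ordn_gt0.
  move=> r; rewrite ordnM ?expf_neq0 // ordnX inE => /predU1P[->|/dP]; last by lia.
  have : (`|coeff p D| <= ordn p x * `|coeff p D|)%N by rewrite leq_pmull.
  lia.
have [d [d0 dP]] := H (dom D); exists d; split=> // p.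
have [/dP //|] := boolP (p \in dom D).
by rewrite mem_dom negbK => /eqP->.
Qed.

Lemma principalN D : principal D -> principal (- D).
Proof.
move=> /(principalE hN hC)[x x0 xD]; apply/(principalE hN hC); exists x^-1.
  by rewrite invr_eq0.
by move=> p; rewrite coeffN xD ordV.
Qed.

Lemma principalD D E : principal D -> principal E -> principal (D + E).
Proof.
move=> /(principalE hN hC)[x x0 xD] /(principalE hN hC)[y y0 yE].
apply/(principalE hN hC); exists (x * y); first exact: mulf_neq0.
by move=> p; rewrite coeffD xD yE ordM.
Qed.

Lemma principal0 : principal (0 : Div A).
Proof.
apply/(principalE hN hC); exists 1; first exact: oner_neq0.
by move=> p; rewrite coeff0 ord_one.
Qed.

Lemma principalMz D n : principal D -> principal (D *~ n).
Proof.
move=> pD; suff H m : principal (D *+ m).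
  by case: n => m; rewrite ?NegzE ?mulrNz; [exact: H | apply: principalN; exact: H].
elim: m => [|m IH]; first by rewrite mulr0n; exact: principal0.
by rewrite mulrS; exact: principalD.
Qed.

Lemma coaffine_equiv D E : principal (D - E) -> coaffine D -> coaffine E.
Proof.
move=> DE cD F eF FE; apply: cD => //; rewrite /lin_equiv.
rewrite (_ : F - D = (F - E) - (D - E)); last by rewrite opprB addrA subrK.
by apply: principalD => //; exact: principalN.
Qed.

(** An effective principal divisor is the divisor of some [a] in [A]; its inverse is regular off the
    support, so [1 = a^-1 * a] is the relation sought. *)
Lemma principal_coaffine D : principal D -> coaffine D.
Proof.
move=> pD E eE ED; apply/affine_complementE.
have /(principalE hN hC)[x x0 xE] : principal E.
  by rewrite -[E](subrK D); exact: principalD.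
have [a aE] : exists a, x = tofrac a.
  by apply: (krull hN hC) => p; apply/(regular_at_ord hN hC) => //; rewrite -xE; exact: eE.
have a0 : a != 0 by rewrite aE tofrac_eq0 in x0.
rewrite -(mulVf x0) {2}aE; apply: affine_spanM; last first.
  apply/affine_span_gen/basic_sub_complement => p; rewrite xE aE ord_tofrac // => h.
  by apply/(ordn_gt0 hN hC) => //; rewrite lt0n.
apply/regular_complement => p pE; apply/(regular_at_ord hN hC); rewrite ?invr_eq0 //.
by rewrite ordV // -xE pE.
Qed.

Lemma strongly_coaffineE D : strongly_coaffine D <-> forall n, coaffine (D *~ n).
Proof.
split=> h n; last by left.
by have [//|/principal_coaffine] := h n.
Qed.

Lemma strongly_coaffine_equiv D E :
  principal (D - E) -> strongly_coaffine D -> strongly_coaffine E.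
Proof.
move=> DE /strongly_coaffineE cD; apply/strongly_coaffineE => n.
apply: coaffine_equiv (cD n); rewrite -mulrzBl; exact: principalMz.
Qed.

End Complement.

(** * Extension of divisors to the polynomial ring *)

Lemma common_multiplier (A : idomainType) (p : Spec A) (t : A) (s : seq A) :
  (forall x, x \in s -> local_dvd p t x) ->
  exists k, ~ spec_set p k /\ forall x, x \in s -> exists r, k * x = r * t.
Proof.
elim: s => [|x s IH] h; first by exists 1; split=> //; exact: spec_nmem1.
have [|k [pk kP]] := IH; first by move=> y ys; apply: h; rewrite inE ys orbT.
have [l [r [pl e]]] := h x (mem_head _ _).
exists (k * l); split; first exact: spec_nmemM.
move=> y; rewrite inE => /predU1P[->|/kP[r' e']].
  by exists (k * r); apply: (lincomb1 (k := k) e); ring.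
by exists (l * r'); apply: (lincomb1 (k := l) e'); ring.
Qed.

Section Extension.
Variable A : idomainType.

(** Gauss's argument: if [i] and [j] are the lowest indices of coefficients of [f] and [g] outside
    [p], the coefficient of index [i + j] of the product is outside [p]. *)
Lemma ext_prime (p : Spec A) : is_prime (poly_extension p).
Proof.
split=> /=.
- split=> [i|a f g pf pg i]; first by rewrite coef0; exact: spec0.
  rewrite coefD coefM; apply: specD => //; apply: spec_sum => k _; exact: specMl.
- by move=> /(_ 0%N); rewrite coef1; exact: spec_nmem1.
move=> f g pfg; apply: contrapT => /not_orP[/existsNP[i0 fi0] /existsNP[j0 gj0]].
have minimal (h : {poly A}) k : ~ spec_set p h`_k ->
    exists i, ~ spec_set p h`_i /\ forall j, (j < i)%N -> spec_set p h`_j.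
  move=> hk; have ex : exists i, ~~ `[< spec_set p h`_i >] by exists k; apply/asboolPn.
  exists (ex_minn ex); case: ex_minnP => i /asboolPn hi min; split=> // j ji.
  by apply: contrapT => /asboolPn/min; rewrite leqNgt ji.
have [i [fi fmin]] := minimal f i0 fi0; have [j [gj gmin]] := minimal g j0 gj0.
apply: (spec_nmemM fi gj).
have := pfg (i + j)%N; rewrite coefM.
have lti : (i < (i + j).+1)%N by rewrite ltnS leq_addr.
rewrite (bigD1 (Ordinal lti)) //= addKn => h.
rewrite -(addrK (\sum_(k < (i + j).+1 | k != Ordinal lti) f`_k * g`_(i + j - k)) (f`_i * g`_j)).
apply: specD => //; rewrite -mulN1r; apply: specMl; apply: spec_sum => k ki.
have [ki'|ik] := ltnP k i; first by apply: specMr; exact: fmin.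
apply: specMl; apply: gmin; rewrite ltn_subLR; last by rewrite -ltnS.
by rewrite ltn_add2r ltn_neqAle ik andbT eq_sym; apply: contraNneq ki => e; apply/eqP/val_inj.
Qed.

Definition ext (p : Spec A) : Spec {poly A} := MkSpec (ext_prime p).

Lemma ext_const (p : Spec A) a : spec_set (ext p) a%:P <-> spec_set p a.
Proof.
split=> [/(_ 0%N)|pa i]; first by rewrite coefC.
by rewrite coefC; case: eqP => // _; exact: spec0.
Qed.

(** A polynomial has finitely many coefficients, so one multiplier [k] serves all of them. *)
Lemma ext_local_dvd (p : Spec A) (b : A) (f : {poly A}) :
  (forall i, local_dvd p b f`_i) ->
  exists k h, ~ spec_set p k /\ k%:P * f = h * b%:P.
Proof.
move=> h; have [|k [pk kP]] := @common_multiplier _ p b f.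
  by move=> _ /(nthP 0)[i _ <-].
have /choice[r rE] : forall i, exists r, k * f`_i = r * b.
  move=> i; have [fi|fi] := ltnP i (size f); first exact/kP/mem_nth.
  by exists 0; rewrite nth_default // mulr0 mul0r.
exists k, (\poly_(i < size f) r i); split=> //; apply/polyP => i.
rewrite coefCM coefMC coef_poly; case: ltnP => fi; first exact: rE.
by rewrite nth_default // mulr0 mul0r.
Qed.

(** From this come both the height one of [pA[T]] and the equality of orders of constants in
    [ordn_const]. *)
Lemma ext_local_gen (p : Spec A) t : local_gen p t -> local_gen (ext p) t%:P.
Proof.
move=> [pt t0 gen]; split; [exact/ext_const | by rewrite polyC_eq0|].
move=> f pf; have [|k [h [pk e]]] := @ext_local_dvd p t f; first by move=> i; apply: gen.
by exists k%:P, h; split=> //; apply/ext_const.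
Qed.

Hypotheses (hN : noetherian A) (hC : completely_integrally_closed A).
Let hN' := hilbert_basis hN.
Let hC' := poly_cic hC.
Implicit Types (p : primeDivisor A) (P : primeDivisor {poly A}) (D E : Div A).

Lemma ext_height_one p : height_one (ext p).
Proof. exact: (@local_gen_height_one _ hN' (ext p) _ (ext_local_gen (lgenP hN hC p))). Qed.

Definition extd p : primeDivisor {poly A} := MkPrimeDivisor (ext_height_one p).

Lemma extd_inj : injective extd.
Proof.
move=> p q e; apply: primeDivisor_sub => a pa.
have : spec_set (extd p) a%:P by apply/ext_const.
by rewrite e => /ext_const.
Qed.

Lemma ordn_const p a : a != 0 -> ordn (extd p) a%:P = ordn p a.
Proof.
move=> a0; have lt := lgenP hN hC p.
have [s [u [ps pu e]]] := ordnP hN hC lt a0.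
apply: (ordn_eq hN' hC' (s := s%:P) (u := u%:P) (ext_local_gen lt : local_gen (extd p) _)).
- by move/ext_const.
- by move/ext_const.
- by rewrite -polyC_exp -!polyCM e.
Qed.

(** The order along [pA[T]] is the minimum [m] of the orders of the non-zero coefficients: in
    [s * g = h * t ^+ m] the coefficient of [h] at an index attaining the minimum is outside [p]. *)
Lemma ordn_coef p (g : {poly A}) i : g`_i != 0 -> (ordn (extd p) g <= ordn p g`_i)%N.
Proof.
move=> gi0; have lt := lgenP hN hC p.
have ex : exists m, [exists j : 'I_(size g), (g`_j != 0) && (ordn p g`_j == m)].
  have gi : (i < size g)%N.
    by rewrite ltnNge; apply: contra_neqN gi0 => h; rewrite nth_default.
  by exists (ordn p g`_i); apply/existsP; exists (Ordinal gi); rewrite gi0 eqxx.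
case: (ex_minnP ex) => m /existsP[j /andP[gj0 /eqP gjm]] mmin.
have minm k : g`_k != 0 -> (m <= ordn p g`_k)%N.
  move=> gk0; apply: mmin; have gk : (k < size g)%N.
    by rewrite ltnNge; apply: contra_neqN gk0 => h; rewrite nth_default.
  by apply/existsP; exists (Ordinal gk); rewrite gk0 eqxx.
have [|s [h [ps e]]] := @ext_local_dvd p (lgen p ^+ m) g.
  move=> k; have [->|gk0] := eqVneq g`_k 0.
    by exists 1, 0; rewrite mulr0 mul0r; split=> //; exact: spec_nmem1.
  by apply/(ordn_ge hN hC _ lt gk0)/minm.
suff -> : ordn (extd p) g = m by exact: minm.
apply: (ordn_eq hN' hC' (s := s%:P) (u := h) (ext_local_gen lt : local_gen (extd p) _)).
- by move/ext_const.
- move=> /(_ j) phj; have [pt t0 gen] := lt.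
  have [s' [r [ps' e']]] := gen _ phj.
  have : (m.+1 <= ordn p g`_j)%N.
    apply/(ordn_ge hN hC _ lt gj0); exists (s' * s), r; split; first exact: spec_nmemM.
    have := congr1 (fun f : {poly A} => f`_j) e; rewrite coefCM coefMC => ej.
    by rewrite exprS; apply: (lincomb2 (k := s') (k' := lgen p ^+ m) ej e'); ring.
  by rewrite gjm ltnn.
- by rewrite e polyC_exp.
Qed.

Lemma pullback_primeE p : pullback_prime p = << extd p >>.
Proof.
rewrite /pullback_prime; case: pselect => [e|ne].
  have eP := projT2 (cid e); congr << _ >>; apply: primeDivisor_sub => f.
  by rewrite eP.
by case: ne; exists (extd p).
Qed.

Lemma coeff_pullback P D :
  coeff P (pullback D) = \sum_(p <- dom D) (extd p == P)%:R * coeff p D.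
Proof.
rewrite /pullback raddf_sum; apply: eq_bigr => p _ /=.
by rewrite pullback_primeE raddfMz /= coeffU mul1r -mulrzr intz.
Qed.

Lemma coeff_pullback_ext p D : coeff (extd p) (pullback D) = coeff p D.
Proof.
rewrite coeff_pullback; have [pD|pD] := boolP (p \in dom D).
  rewrite (bigD1_seq p) ?uniq_dom //= eqxx mul1r big1 ?addr0 // => q qp.
  by rewrite (inj_eq extd_inj) (negPf qp) mul0r.
rewrite [RHS]coeff_outdom // big_seq big1 // => q qD.
rewrite (inj_eq extd_inj); case: eqP => [e|_]; last by rewrite mul0r.
by rewrite e (negPf pD) in qD.
Qed.

Lemma coeff_pullback_out P D : (forall p, P <> extd p) -> coeff P (pullback D) = 0.
Proof.
move=> h; rewrite coeff_pullback big1 // => p _; case: eqP => [e|_]; last by rewrite mul0r.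
by case: (h p).
Qed.

(** Vertical against horizontal prime divisors: identities of divisors on [A[T]] are checked on the
    two kinds separately. *)
Lemma extdP P : (exists p, P = extd p) \/ (forall p, P <> extd p).
Proof.
have [h|h] := pselect (exists p, P = extd p); [by left | right=> p e].
by apply: h; exists p.
Qed.

Lemma pullbackB D E : pullback (D - E) = pullback D - pullback E.
Proof.
apply: freegP => P; rewrite coeffB; have [[p ->]|h] := extdP P.
  by rewrite !coeff_pullback_ext coeffB.
by rewrite !coeff_pullback_out // subr0.
Qed.

Lemma pullbackD D E : pullback (D + E) = pullback D + pullback E.
Proof.
apply: freegP => P; rewrite coeffD; have [[p ->]|h] := extdP P.
  by rewrite !coeff_pullback_ext coeffD.
by rewrite !coeff_pullback_out // addr0.
Qed.

Lemma pullbackMz D n : pullback (D *~ n) = pullback D *~ n.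
Proof.
apply: freegP => P; rewrite raddfMz /=; have [[p ->]|h] := extdP P.
  by rewrite !coeff_pullback_ext raddfMz.
by rewrite !coeff_pullback_out // mul0rz.
Qed.

Lemma pullback_effective D : effective D -> effective (pullback D).
Proof.
move=> eD P; have [[p ->]|h] := extdP P; first by rewrite coeff_pullback_ext.
by rewrite coeff_pullback_out.
Qed.

(** The contraction of [P] to [A] contains [a], so [1 / a] is not in the localization there and some
    prime divisor [p] lies inside the contraction. Then [pA[T]] is contained in [P], and both have
    height one. *)
Lemma extd_meet P a : a != 0 -> spec_set P a%:P -> exists p, P = extd p.
Proof.
move=> a0 Pa; have pP : is_prime [set b | spec_set P b%:P].
  split=> /=; first split=> /=; first exact: spec0.
  - by move=> b x y Px Py; rewrite polyCD polyCM; apply: specD => //; exact: specMl.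
  - exact: spec_nmem1.
  by move=> x y; rewrite polyCM; have [_ _] := spec_prime P; apply.
have [|p [pq _]] := exists_prime_divisor hN hC (q := MkSpec pP) (a := 1) a0.
  by move=> [s [r [ps e]]]; apply: ps; rewrite /= -[s]mulr1 e polyCM; exact: specMl.
exists p; apply/esym/primeDivisor_sub => f pf.
rewrite -[f]coefK poly_def; apply: spec_sum => i _; rewrite -mul_polyC.
by apply: specMr; exact: pq.
Qed.

Lemma ordn_const_out P a : (forall p, P <> extd p) -> a != 0 -> ordn P a%:P = 0%N.
Proof.
move=> h a0; apply: (ordn_eq0 hN' hC') => Pa.
by have [p] := extd_meet a0 Pa; exact: h.
Qed.

End Extension.

(** * Divisors on the polynomial ring up to linear equivalence *)

Section Contraction.
Variable A : idomainType.
Hypotheses (hN : noetherian A) (hC : completely_integrally_closed A).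
Let hN' := hilbert_basis hN.
Let hC' := poly_cic hC.
Local Notation extd := (extd hN hC).
Implicit Types (p : primeDivisor A) (P : primeDivisor {poly A}) (D E : Div A).

Lemma contract_div (G : Div {poly A}) : exists D, forall p, coeff p D = coeff (extd p) G.
Proof.
rewrite -[G]freeg_sumE; elim/big_ind: _ => [|G1 G2 [D1 h1] [D2 h2]|P _].
- by exists 0 => p; rewrite !coeff0.
- by exists (D1 + D2) => p; rewrite !coeffD h1 h2.
have [[q ->]|h] := extdP hN hC P.
  exists << coeff (extd q) G *g q >> => p.
  by rewrite !coeffU (inj_eq (@extd_inj _ hN hC)).
exists 0 => p; rewrite coeff0 coeffU; case: eqP => [e|]; last by rewrite mulr0.
by case: (h p).
Qed.

Lemma pullback_contract (G : Div {poly A}) :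
  (forall P, (forall p, P <> extd p) -> coeff P G = 0) -> exists D, G = pullback D.
Proof.
move=> h; have [D DE] := contract_div G; exists D; apply: freegP => P.
have [[p ->]|Pp] := extdP hN hC P; first by rewrite coeff_pullback_ext DE.
by rewrite h // (coeff_pullback_out _ Pp).
Qed.

(** An element of [P] of minimal degree works, by pseudo-division. *)
Lemma horizontal_generator P : (forall p, P <> extd p) ->
  exists g : {poly A}, [/\ g != 0, ordn P g = 1%N &
    forall Q : primeDivisor {poly A}, (forall p, Q <> extd p) -> Q <> P -> ordn Q g = 0%N].
Proof.
move=> hP; have [[f0 Pf0 f00] _] := pd_height P.
have ex : exists n, `[< exists f : {poly A}, [/\ spec_set P f, f != 0 & size f = n] >].
  by exists (size f0); apply/asboolP; exists f0.
case: (ex_minnP ex) => n /asboolP[g [Pg g0 gn]] gmin.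
have div f : spec_set P f -> exists c k, c != 0 /\ c%:P * f = k * g.
  move=> Pf; pose c := lead_coef g ^+ scalp f g.
  have c0 : c != 0 by rewrite expf_neq0 // lead_coef_eq0.
  exists c, (f %/ g); split=> //; rewrite mul_polyC (Pdiv.Idomain.divp_eq f g).
  suff -> : f %% g = 0 by rewrite addr0.
  apply/eqP; apply: contraT => r0.
  have := ltn_modp f g; rewrite g0 ltnNge gn gmin //; apply/asboolP.
  exists (f %% g); split=> //.
  have -> : f %% g = c%:P * f + (- (f %/ g)) * g.
    by rewrite mul_polyC Pdiv.Idomain.divp_eq; ring.
  by apply: specD; exact: specMl.
have const_out Q c : (forall p, Q <> extd p) -> c != 0 -> ~ spec_set Q c%:P.
  by move=> hQ c0 /(extd_meet hN hC c0)[p]; exact: hQ.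
have lg : local_gen P g.
  split=> // f /div[c [k [c0 e]]]; exists c%:P, k; split=> //; exact: const_out.
exists g; split=> //.
  apply: (ordn_eq hN' hC' (s := 1) (u := 1) lg); [exact: spec_nmem1.. |].
  by rewrite expr1.
(* A horizontal [Q] contains no non-zero constant, so [c%:P * f = k * g] with [g] in [Q] would force
   [P] into [Q]. *)
move=> Q hQ QP; apply: (ordn_eq0 hN' hC') => Qg; apply: QP; apply/esym/primeDivisor_sub.
move=> f /div[c [k [c0 e]]].
have : spec_set Q (c%:P * f) by rewrite e; exact: specMl.
by have [_ _ QP] := spec_prime Q => /QP[/(const_out _ _ hQ c0)|].
Qed.

Lemma pullback_surjective (G : Div {poly A}) : exists D, principal (G - pullback D).
Proof.
rewrite -[G]freeg_sumE; elim/big_ind: _ => [|G1 G2 [D1 h1] [D2 h2]|P _].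
- exists 0; have := pullbackB hN hC 0 0; rewrite !subrr => ->; rewrite subrr.
  exact: principal0 hN' hC'.
- exists (D1 + D2); rewrite (pullbackD hN hC) opprD addrACA; exact: (principalD hN' hC').
suff [D DP] : exists D, principal (<< P >> - pullback D).
  exists (D *~ coeff P G); rewrite (pullbackMz hN hC).
  have -> : << coeff P G *g P >> = << P >> *~ coeff P G :> Div {poly A}.
    by rewrite freegU_mulz intz.
  by rewrite -mulrzBl; exact: (principalMz hN' hC').
have [[q ->]|hP] := extdP hN hC P.
  exists << q >>; rewrite (_ : _ - _ = 0); first exact: principal0 hN' hC'.
  apply/eqP; rewrite subr_eq0; apply/eqP/freegP => Q.
  have [[p ->]|hQ] := extdP hN hC Q.
    by rewrite coeff_pullback_ext !coeffU (inj_eq (@extd_inj _ hN hC)).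
  rewrite (coeff_pullback_out _ hQ) coeffU; case: eqP => [e|]; last by rewrite mulr0.
  by case: (hQ q).
have [g [g0 gP gQ]] := horizontal_generator hP.
have [divg divgE] : exists E : Div {poly A}, forall Q, coeff Q E = ord Q (tofrac g).
  by apply: (exists_div hN' hC'); rewrite tofrac_eq0.
(* Horizontally the divisor of [g] is exactly [P], so the difference has only vertical
   components. *)
have [D DE] : exists D, << P >> - divg = pullback D.
  apply: pullback_contract => Q hQ; rewrite coeffB coeffU divgE mul1r (ord_tofrac hN' hC') //.
  by have [<-|/eqP QP] := eqVneq P Q; [rewrite gP | rewrite gQ // => e; case: QP].
exists D; rewrite -DE opprB addrC subrK; apply/(principalE hN' hC').
by exists (tofrac g); rewrite ?tofrac_eq0.
Qed.

End Contraction.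

Section FractionExtension.
Variable A : idomainType.

Lemma frac_pair (x : {fraction A}) :
  exists ab : A * A, ab.2 != 0 /\ x = tofrac ab.1 / tofrac ab.2.
Proof. by have [a [b h]] := fracW x; exists (a, b). Qed.

Definition frac_ext (x : {fraction A}) : {fraction {poly A}} :=
  let ab := projT1 (cid (frac_pair x)) in tofrac ab.1%:P / tofrac ab.2%:P.

Lemma frac_extE a b : b != 0 -> frac_ext (tofrac a / tofrac b) = tofrac a%:P / tofrac b%:P.
Proof.
move=> b0; rewrite /frac_ext; case: cid => -[c d] /= [d0 /(frac_eq _ _ b0 d0) e].
by apply/frac_eq; rewrite ?polyC_eq0 // -!polyCM e.
Qed.

Lemma frac_ext_tofrac a : frac_ext (tofrac a) = tofrac a%:P.
Proof.
by rewrite -[tofrac a]divr1 -tofrac1 frac_extE ?oner_neq0 // polyC1 tofrac1 divr1.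
Qed.

Lemma frac_extD x y : frac_ext (x + y) = frac_ext x + frac_ext y.
Proof.
have [a [b [b0 ->]]] := fracW x; have [c [d [d0 ->]]] := fracW y.
rewrite addf_div ?tofrac_eq0 // -!tofracM -tofracD !frac_extE ?mulf_neq0 //.
by rewrite addf_div ?tofrac_eq0 ?polyC_eq0 // polyCD !polyCM tofracD !tofracM.
Qed.

Lemma frac_extM x y : frac_ext (x * y) = frac_ext x * frac_ext y.
Proof.
have [a [b [b0 ->]]] := fracW x; have [c [d [d0 ->]]] := fracW y.
rewrite mulf_div -!tofracM !frac_extE ?mulf_neq0 //.
by rewrite mulf_div !polyCM !tofracM.
Qed.

Lemma frac_ext1 : frac_ext 1 = 1.
Proof. by rewrite -tofrac1 frac_ext_tofrac polyC1 tofrac1. Qed.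

Lemma frac_ext0 : frac_ext 0 = 0.
Proof. by rewrite -tofrac0 frac_ext_tofrac polyC0 tofrac0. Qed.

Lemma frac_ext_neq0 x : x != 0 -> frac_ext x != 0.
Proof.
move=> /fracW_neq0[a [b [a0 b0 ->]]].
by rewrite frac_extE // frac_neq0 ?polyC_eq0.
Qed.

Lemma frac_ext_sum (T : Type) (s : seq T) (F : T -> {fraction A}) :
  frac_ext (\sum_(i <- s) F i) = \sum_(i <- s) frac_ext (F i).
Proof.
by elim/big_rec2: _ => [|i y1 y2 _ <-]; rewrite ?frac_ext0 // frac_extD.
Qed.

Hypotheses (hN : noetherian A) (hC : completely_integrally_closed A).
Let hN' := hilbert_basis hN.
Let hC' := poly_cic hC.

Lemma ord_frac_ext p x : x != 0 -> ord (extd hN hC p) (frac_ext x) = ord p x.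
Proof.
move=> /fracW_neq0[a [b [a0 b0 ->]]]; rewrite frac_extE //.
by rewrite (ord_frac hN' hC') ?polyC_eq0 // (ord_frac hN hC) // !ordn_const.
Qed.

Lemma ord_frac_ext_out P x : (forall p, P <> extd hN hC p) -> x != 0 ->
  ord P (frac_ext x) = 0.
Proof.
move=> hP /fracW_neq0[a [b [a0 b0 ->]]]; rewrite frac_extE //.
by rewrite (ord_frac hN' hC') ?polyC_eq0 // !(ordn_const_out hP) // subrr.
Qed.

Lemma principal_pullback (D : Div A) : principal D -> principal (pullback D).
Proof.
move=> /(principalE hN hC)[x x0 xD]; apply/(principalE hN' hC').
exists (frac_ext x); first exact: frac_ext_neq0.
move=> P; have [[p ->]|hP] := extdP hN hC P.
  by rewrite coeff_pullback_ext ord_frac_ext.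
by rewrite (coeff_pullback_out _ hP) ord_frac_ext_out.
Qed.

End FractionExtension.

(** * Coaffine divisors and pull-back *)

Section Radical.
Variables (A : idomainType) (U : set (Spec A)).
Implicit Types x y : {fraction A}.

Definition regular_off x := forall q, U q -> regular_at q x.

Lemma affine_spanMn x n : affine_span U x -> affine_span U (x *+ n).
Proof.
move=> Ux; elim: n => [|n IH]; first by rewrite mulr0n; exact: affine_span0.
by rewrite mulrS; exact: affine_spanD.
Qed.

Lemma affine_span_sum (T : eqType) (s : seq T) (F : T -> {fraction A}) :
  (forall z, z \in s -> affine_span U (F z)) -> affine_span U (\sum_(z <- s) F z).
Proof.
move=> h; rewrite big_seq; elim/big_ind: _ => //; first exact: affine_span0.
by move=> x y; exact: affine_spanD.
Qed.

(** The radical absorbs multiplicities: equations vanishing to different orders along the same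
    divisors become comparable. *)
Definition affine_radical x := regular_off x /\ exists n, affine_span U (x ^+ n).

Lemma affine_radicalD x y : affine_radical x -> affine_radical y -> affine_radical (x + y).
Proof.
move=> [xU [n xn]] [yU [m ym]]; split.
  by move=> q Uq; apply: regular_atD; [exact: xU | exact: yU].
exists (n + m)%N; rewrite exprDn.
elim/big_ind: _ => [|u v|i _]; [exact: affine_span0 | exact: affine_spanD |].
(* In each binomial term either [y] has exponent at least [m] or [x] has exponent at least [n]. *)
apply: affine_spanMn; have [im|/ltnW mi] := leqP m i.
  rewrite -(subnK im) exprD mulrA; apply: affine_spanM => // q Uq.
  by apply: regular_atM; apply: regular_atX; [exact: xU | exact: yU].
have -> : (n + m - i = (m - i) + n)%N by lia.
rewrite mulrC exprD mulrA; apply: affine_spanM => // q Uq.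
by apply: regular_atM; apply: regular_atX; [exact: yU | exact: xU].
Qed.

Lemma affine_radicalM x y : regular_off x -> affine_radical y -> affine_radical (x * y).
Proof.
move=> xU [yU [m ym]]; split.
  by move=> q Uq; apply: regular_atM; [exact: xU | exact: yU].
by exists m; rewrite exprMn; apply: affine_spanM => // q Uq; apply: regular_atX; exact: xU.
Qed.

Lemma affine_radical0 : affine_radical 0.
Proof. by split=> [q _|]; [exact: regular_at0 | exists 1%N; exact: affine_span0]. Qed.

Lemma affine_radical_sum (T : eqType) (s : seq T) (F : T -> {fraction A}) :
  (forall z, z \in s -> affine_radical (F z)) -> affine_radical (\sum_(z <- s) F z).
Proof.
move=> h; rewrite big_seq; elim/big_ind: _ => //; first exact: affine_radical0.
by move=> x y; exact: affine_radicalD.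
Qed.

Lemma affine_radicalX x n : regular_off x -> affine_radical (x ^+ n) -> affine_radical x.
Proof. by move=> xU [_ [m h]]; split=> //; exists (n * m)%N; rewrite exprM. Qed.

Lemma affine_radical1 : affine_radical 1 -> affine_span U 1.
Proof. by move=> [_ [n]]; rewrite expr1n. Qed.

End Radical.

Lemma div_bound (A : idomainType) (D : Div A) : exists N : nat, forall p, coeff p D <= N%:Z.
Proof.
suff [N NP] : exists N : nat, forall p, p \in dom D -> coeff p D <= N%:Z.
  exists N => p; have [/NP//|] := boolP (p \in dom D).
  by rewrite mem_dom negbK => /eqP->.
elim: (dom D) => [|p s [N NP]]; first by exists 0%N.
exists (N + `|coeff p D|)%N => q; rewrite inE => /predU1P[->|/NP]; lia.
Qed.

Section Coaffine.
Variable A : idomainType.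
Hypotheses (hN : noetherian A) (hC : completely_integrally_closed A).
Let hN' := hilbert_basis hN.
Let hC' := poly_cic hC.
Local Notation extd := (extd hN hC).
Implicit Types (p : primeDivisor A) (P : primeDivisor {poly A}) (D E : Div A).

(** The poles of [x] lie on vertical divisors; [D] collects their orders, and an element of [A] of
    at least these orders clears them. *)
Lemma const_denominator (E : Div A) (x : {fraction {poly A}}) :
  regular_off (complement (pullback E)) x ->
  exists d : A, d != 0 /\ exists h, tofrac d%:P * x = tofrac h.
Proof.
move=> /(regular_complement hN' hC') xE.
have [->|x0] := eqVneq x 0.
  by exists 1; rewrite oner_neq0; split=> //; exists 0; rewrite mulr0 tofrac0.
have [G GE] := exists_div hN' hC' x0.
have [D DE] := contract_div hN hC (- G).
have [d [d0 dP]] := exists_denominator hN hC D.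
exists d; split=> //; apply: (krull hN' hC') => P.
have dF : tofrac d%:P != 0 :> {fraction {poly A}} by rewrite tofrac_eq0 polyC_eq0.
have yF := mulf_neq0 dF x0.
apply: (proj2 (regular_at_ord hN' hC' P yF)).
have d0' : d%:P != 0 :> {poly A} by rewrite polyC_eq0.
rewrite (ordM hN' hC' P dF x0) (ord_tofrac hN' hC' P d0').
have [[p ->]|hP] := extdP hN hC P.
  rewrite ordn_const //; have := dP p; rewrite DE coeffN GE; lia.
have := proj1 (regular_at_ord hN' hC' P x0) (xE P (coeff_pullback_out _ hP)).
lia.
Qed.

(** Why constant coefficients work: membership in [pA[T]] is tested on coefficients, so equations
    stay equations. By [ordn_coef] the constant coefficient of [h z] has at [p] at least the order
    of [h z] along [pA[T]], which off [E] is at least that of [d]; so the quotient by [d] stays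
    regular. *)
Lemma affine_span_descent E :
  affine_span (complement (pullback E)) 1 -> affine_span (complement E) 1.
Proof.
move=> [s [sP e1]].
have [d [d0 dP]] : exists d : A, d != 0 /\
    forall z, z \in s -> exists h, tofrac d%:P * z.2 = tofrac h.
  elim: s sP {e1} => [|z s IH] sP; first by exists 1; rewrite oner_neq0.
  have [|d [d0 dP]] := IH; first by move=> y ys; apply: sP; rewrite inE ys orbT.
  have [c [c0 [h hE]]] := const_denominator (sP z (mem_head _ _)).2.
  exists (c * d); split; first exact: mulf_neq0.
  move=> y; rewrite inE polyCM tofracM => /predU1P[->|/dP[h' h'E]].
    by exists (d%:P * h); rewrite tofracM -hE; ring.
  by exists (c%:P * h'); rewrite tofracM -h'E; ring.
have /choice[h hE] : forall z, exists h, z \in s -> tofrac d%:P * z.2 = tofrac h.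
  by move=> z; have [/dP[h hE]|_] := boolP (z \in s); [exists h | exists 0].
have dE : d%:P = \sum_(z <- s) z.1 * h z.
  apply: tofrac_inj; rewrite -[LHS]mulr1 e1 big_distrr rmorph_sum /=.
  rewrite big_seq [RHS]big_seq; apply: eq_bigr => z zs.
  by rewrite tofracM -(hE _ zs); ring.
have {}dE : d = \sum_(z <- s) z.1`_0 * (h z)`_0.
  rewrite -[LHS](coefC d 0) dE coef_sum; apply: eq_bigr => z _.
  by rewrite coefM big_ord_recl big_ord0 addr0.
have dF : tofrac d != 0 :> {fraction A} by rewrite tofrac_eq0.
rewrite -(divff dF) {1}dE rmorph_sum big_distrl /=; apply: affine_span_sum => z zs.
have [zgen zreg] := sP _ zs.
rewrite tofracM -mulrA mulrC; apply: affine_spanM; last first.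
  apply/affine_span_gen/basic_sub_complement => p pE.
  by have /basic_sub_complement/(_ (extd p)) := zgen; rewrite coeff_pullback_ext; apply.
apply/(regular_complement hN hC) => p pE.
have [->|h0] := eqVneq (h z)`_0 0; first by rewrite tofrac0 mul0r; exact: regular_at0.
apply/(regular_at_ord hN hC); first by rewrite frac_neq0.
rewrite (ord_frac hN hC) //.
have hz0 : h z != 0 by apply: contra_neq h0 => ->; rewrite coef0.
have le1 := ordn_coef hN hC p h0.
have dF' : tofrac d%:P != 0 :> {fraction {poly A}} by rewrite tofrac_eq0 polyC_eq0.
have z20 : z.2 != 0.
  by apply: contra_neq hz0 => z20; apply: tofrac_inj; rewrite -(hE _ zs) z20 mulr0 tofrac0.
have zp : coeff (extd p) (pullback E) = 0 by rewrite coeff_pullback_ext.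
have le2 := proj1 (regular_at_ord hN' hC' _ z20)
  (proj1 (regular_complement hN' hC' _ _) zreg _ zp).
have d0' : d%:P != 0 :> {poly A} by rewrite polyC_eq0.
have := congr1 (ord (extd p)) (hE _ zs).
rewrite (ordM hN' hC' _ dF' z20) (ord_tofrac hN' hC' _ d0') (ord_tofrac hN' hC' _ hz0).
rewrite ordn_const //; move: le1 le2.
move: (ordn _ (h z)) (ord _ z.2) (ordn p (h z)`_0) (ordn p d) => u v w y; lia.
Qed.

Lemma coaffine_descent D : coaffine (pullback D) -> coaffine D.
Proof.
move=> cD E eE ED; apply/affine_complementE/affine_span_descent/affine_complementE.
apply: cD; first exact: pullback_effective.
by rewrite /lin_equiv -(pullbackB hN hC); exact: (principal_pullback hN hC).
Qed.

End Coaffine.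

Section Ascent.
Variable A : idomainType.
Hypotheses (hN : noetherian A) (hC : completely_integrally_closed A).
Let hN' := hilbert_basis hN.
Let hC' := poly_cic hC.
Local Notation extd := (extd hN hC).
Implicit Types (p : primeDivisor A) (P : primeDivisor {poly A}) (D E : Div A).

(** Write [1 = sum a_j b_j] with [a_j] vanishing on [E] and [b_j] regular off [E].
    A high power of [a_j] divided by [w] vanishes on [F], and [w ^+ N * b_j] is
    regular off [F] for large [N]. *)
Lemma affine_radical_over (F : Div {poly A}) (E : Div A) (w : {fraction {poly A}}) :
  effective F -> effective E -> w != 0 ->
  (forall P, ord P w = coeff P (pullback E) - coeff P F) ->
  affine_span (complement E) 1 -> affine_radical (complement F) w.
Proof.
move=> eF eE w0 wE [s [sP e1]].
have Ext0 p : 0 <= coeff p E := eE p.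
have regF x : x != 0 -> (forall P, coeff P F = 0 -> 0 <= ord P x) ->
    regular_off (complement F) x.
  move=> x0 h; apply: (proj2 (regular_complement hN' hC' F x)) => P PF.
  by apply: (proj2 (regular_at_ord hN' hC' P x0)); exact: h.
have wreg : regular_off (complement F) w.
  apply: regF => // P PF; rewrite wE PF subr0; exact: (pullback_effective hN hC eE).
have [M MP] := div_bound E.
have gens z : z \in s -> affine_radical (complement F) (frac_ext (tofrac z.1)).
  move=> zs; have [->|z0] := eqVneq z.1 0.
    by rewrite tofrac0 frac_ext0; exact: affine_radical0.
  have zp p : coeff p E != 0 -> (0 < ordn p z.1)%N.
    move=> pE; apply: (proj2 (ordn_gt0 hN hC p z0)).
    exact: (proj1 (basic_sub_complement E z.1) (sP z zs).1).
  have z0' : (z.1)%:P != 0 :> {poly A} by rewrite polyC_eq0.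
  (* [M] bounds the multiplicities of [E], so on [E] the order of [z.1 ^+ M.+1] exceeds that of [E].
     Thus [y] is an element of [A[T]] vanishing on [F], and the power equals [w * y]. *)
  rewrite frac_ext_tofrac; apply: (affine_radicalX (n := M.+1)).
    by move=> q _; exact: regular_at_tofrac.
  split; first by move=> q _; rewrite -tofracXn; exact: regular_at_tofrac.
  exists 1%N; rewrite expr1.
  pose y := tofrac (z.1)%:P ^+ M.+1 / w.
  have zF0 : tofrac (z.1)%:P != 0 :> {fraction {poly A}} by rewrite tofrac_eq0.
  have zM0 := expf_neq0 M.+1 zF0.
  have w0' := invr_neq0 w0.
  have y0 : y != 0 := mulf_neq0 zM0 w0'.
  have yord P : ord P y = (ordn P (z.1)%:P)%:Z *+ M.+1 + (coeff P F - coeff P (pullback E)).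
    rewrite (ordM hN' hC' P zM0 w0') (ordX hN' hC' P _ zF0) (ord_tofrac hN' hC' P z0').
    by rewrite (ordV hN' hC') wE opprB.
  have yF P : coeff P F <= ord P y /\ (coeff P F != 0 -> 0 < ord P y).
    rewrite yord; have [[p ->]|hP] := extdP hN hC P.
      rewrite coeff_pullback_ext ordn_const //; have := eF (extd p).
      have := MP p; have := Ext0 p; have := zp p.
      move: (coeff p E) (coeff _ F) (ordn p z.1); clear=> e f o; rewrite -mulr_natr.
      have [->|e0] := eqVneq e 0; first by move=> _ _ _ f0; split; nia.
      by move=> /(_ isT) o0 _ eM f0; split; nia.
    rewrite (coeff_pullback_out _ hP) (ordn_const_out hP) // mul0rn add0r subr0.
    have := eF P; move: (coeff P F) ; clear=> f f0; split; lia.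
  have [c cE] : exists c, y = tofrac c.
    apply: (krull hN' hC') => P; apply: (proj2 (regular_at_ord hN' hC' P y0)).
    exact: le_trans (eF P) (yF P).1.
  have c0 : c != 0 by move: y0; rewrite cE tofrac_eq0.
  rewrite (esym (etrans (mulrC w y) (mulfVK w0 _)) : tofrac (z.1)%:P ^+ M.+1 = w * y).
  apply: affine_spanM => //; rewrite cE; apply/affine_span_gen/basic_sub_complement => P PF.
  apply: (proj1 (ordn_gt0 hN' hC' P c0)); have := (yF P).2 PF.
  by rewrite cE (ord_tofrac hN' hC' P c0).
(* Off [F] the order of [w] is the multiplicity of [pullback E], positive wherever [z.2] can have a
   pole; a power at least the largest pole order compensates it. *)
have [N NP] : exists N, forall z, z \in s ->
    regular_off (complement F) (w ^+ N * frac_ext z.2).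
  have : forall z, z \in s -> regular_off (complement E) z.2 by move=> z /sP[].
  elim: (s) => [|z r IH] zr; first by exists 0%N.
  have [|N NP] := IH; first by move=> y yr; apply: zr; rewrite inE yr orbT.
  have [K KP] : exists K, regular_off (complement F) (w ^+ K * frac_ext z.2).
    have [->|z0] := eqVneq z.2 0.
      by exists 0%N => q _; rewrite frac_ext0 mulr0; exact: regular_at0.
    have [G GE] := exists_div hN hC z0; have [K KP] := div_bound (- G).
    have wK0 := expf_neq0 K w0; have z0' := frac_ext_neq0 z0.
    exists K; apply: (regF _ (mulf_neq0 wK0 z0')) => P PF.
    rewrite (ordM hN' hC' P wK0 z0') (ordX hN' hC' P _ w0) wE PF subr0.
    have [[p ->]|hP] := extdP hN hC P; last first.
      by rewrite (coeff_pullback_out _ hP) (ord_frac_ext_out hP) // mul0rn.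
    rewrite coeff_pullback_ext ord_frac_ext //.
    have := KP p; rewrite coeffN GE.
    have := Ext0 p; have := proj1 (regular_complement hN hC E z.2) (zr z (mem_head _ _)) p.
    move=> /[swap]; have [e0|e0] := eqVneq (coeff p E) 0.
      by move=> _ /(_ e0) /(proj1 (regular_at_ord hN hC p z0)) + _; rewrite e0 mul0rn add0r.
    move: (coeff p E) e0 (ord p z.2) => e e0 o e0' _ oK; rewrite -mulr_natr; nia.
  exists (K + N)%N => y; rewrite inE => /predU1P[->|/NP h] q qF.
    rewrite addnC exprD -mulrA; apply: regular_atM; last exact: KP.
    by apply: regular_atX; exact: wreg.
  rewrite exprD -mulrA; apply: regular_atM; last exact: h.
  by apply: regular_atX; exact: wreg.
apply: (affine_radicalX (n := N)) => //.
rewrite -[w ^+ N]mulr1 -frac_ext1 e1 frac_ext_sum big_distrr /=.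
apply: affine_radical_sum => z zs; rewrite frac_extM mulrCA mulrC.
by apply: affine_radicalM; [exact: NP | exact: gens].
Qed.

Lemma coaffine_ascent D : coaffine D -> coaffine (pullback D).
Proof.
move=> cD F eF /(principalE hN' hC')[x x0 xE]; apply/affine_complementE.
have [d [d0 dP]] := exists_denominator hN hC D.
have dF0 : tofrac d != 0 :> {fraction A} by rewrite tofrac_eq0.
have d0' : d%:P != 0 :> {poly A} by rewrite polyC_eq0.
have dF0' : tofrac d%:P != 0 :> {fraction {poly A}} by rewrite tofrac_eq0.
have y0 := mulf_neq0 x0 dF0'.
have yE P : ord P (x * tofrac d%:P) = coeff P F - coeff P (pullback D) + (ordn P d%:P)%:Z.
  by rewrite (ordM hN' hC' P x0 dF0') (ord_tofrac hN' hC' P d0') -xE coeffB.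
(* [x] may have poles along the positive part of [pullback D]; the constant [d], of order at least
   [D] everywhere, removes them. *)
have [g gE] : exists g, x * tofrac d%:P = tofrac g.
  apply: (krull hN' hC') => P; apply: (proj2 (regular_at_ord hN' hC' P y0)).
  rewrite yE; have := eF P; have [[p ->]|hP] := extdP hN hC P.
    rewrite coeff_pullback_ext ordn_const //; have := dP p.
    move: (coeff p D) (coeff _ F) (ordn p d) => u v n; clear; lia.
  rewrite (coeff_pullback_out _ hP); move: (coeff P F) (ordn P _) => v n; clear; lia.
have g0 : g != 0 by move: y0; rewrite gE tofrac_eq0.
have gord P : (ordn P g)%:Z = coeff P F - coeff P (pullback D) + (ordn P d%:P)%:Z.
  by rewrite -(ord_tofrac hN' hC' P g0) -gE yE.
have gF0 : tofrac g != 0 :> {fraction {poly A}} by rewrite tofrac_eq0.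
apply: affine_radical1.
have -> : 1 = \sum_(i <- iota 0 (size g)) tofrac 'X^i * (tofrac (g`_i)%:P / tofrac g).
  apply: (mulIf gF0); rewrite mul1r big_distrl /= -{1}[g]coefK poly_def rmorph_sum /=.
  rewrite -(big_mkord xpredT (fun i => tofrac (g`_i *: 'X^i))) /index_iota subn0.
  apply: eq_bigr => i _; rewrite -mulrA mulfVK // -tofracM.
  by rewrite mulrC mul_polyC.
apply: affine_radical_sum => i _; apply: affine_radicalM.
  by move=> q _; exact: regular_at_tofrac.
have [->|gi0] := eqVneq g`_i 0.
  by rewrite polyC0 tofrac0 mul0r; exact: affine_radical0.
have gi0' : (g`_i)%:P != 0 :> {poly A} by rewrite polyC_eq0.
have giF0 : tofrac g`_i != 0 :> {fraction A} by rewrite tofrac_eq0.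
have q0 : tofrac g`_i / tofrac d != 0 by rewrite frac_neq0.
have [G GE] := exists_div hN hC q0.
have EE p : coeff p (D + G) = coeff p D + ((ordn p g`_i)%:Z - (ordn p d)%:Z).
  by rewrite coeffD GE (ord_frac hN hC).
(* By [ordn_coef] the order of the coefficient is at least that of [g] along [pA[T]], which is
   [F - D] plus the order of [d]; so the multiplicity of [D + G] is at least that of [F]. *)
have eE : effective (D + G).
  move=> p; rewrite EE; have := gord (extd p); rewrite coeff_pullback_ext ordn_const //.
  have := eF (extd p); have := ordn_coef hN hC p gi0.
  move: (ordn (extd p) g) (coeff (extd p) F) => n v.
  move: (coeff p D) (ordn p d) (ordn p g`_i); clear; lia.
have giF0' : tofrac (g`_i)%:P != 0 :> {fraction {poly A}} by rewrite tofrac_eq0.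
apply: (affine_radical_over eF eE (mulf_neq0 giF0' (invr_neq0 gF0))).
  move=> P; rewrite (ord_frac hN' hC' P gi0' g0) (gord P) (pullbackD hN hC) coeffD.
  have [[p ->]|hP] := extdP hN hC P.
    by rewrite !coeff_pullback_ext !ordn_const // GE (ord_frac hN hC) //; ring.
  by rewrite !(coeff_pullback_out _ hP) !(ordn_const_out hP) //; ring.
apply/affine_complementE; apply: cD => //.
rewrite /lin_equiv addrC addKr; apply/(principalE hN hC).
by exists (tofrac g`_i / tofrac d).
Qed.

End Ascent.

(** * Affine class groups *)

Section AffineClass.
Variable A : idomainType.
Implicit Types D E : Div A.

Lemma affine_trivialP D : D \in affine_trivial (A := A) <->
  forall E, strongly_coaffine E -> strongly_coaffine (D + E).
Proof. by split=> [/asboolP|h]; last exact/asboolP. Qed.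

Lemma affine_class_eq D E :
  affine_class D = affine_class E <-> D - E \in affine_trivial (A := A).
Proof. by split=> [/eqmodP|h]; last exact/eqmodP. Qed.

Lemma affine_classB D E : affine_class (D - E) = affine_class D - affine_class E.
Proof. exact: raddfB. Qed.

Lemma affine_classW (x : affine_class_group A) : exists D, x = affine_class D.
Proof. by exists (repr x); rewrite /affine_class reprK. Qed.

End AffineClass.

Section Pullback.
Variable A : idomainType.
Hypotheses (hN : noetherian A) (hC : completely_integrally_closed A).
Let hN' := hilbert_basis hN.
Let hC' := poly_cic hC.
Implicit Types D E : Div A.

Lemma strongly_coaffine_pullback D :
  strongly_coaffine (pullback D) <-> strongly_coaffine D.
Proof.
split=> [/(strongly_coaffineE hN' hC') h|/(strongly_coaffineE hN hC) h].
  apply/(strongly_coaffineE hN hC) => n; apply: (coaffine_descent hN hC).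
  by rewrite (pullbackMz hN hC).
apply/(strongly_coaffineE hN' hC') => n; rewrite -(pullbackMz hN hC).
exact: (coaffine_ascent hN hC).
Qed.

(** From [A] to [A[T]] the test divisor [E] may fail to be a pull-back; it is replaced by a linearly
    equivalent one that is, which preserves strong coaffineness. *)
Lemma affine_trivial_pullback D :
  pullback D \in affine_trivial (A := {poly A}) <-> D \in affine_trivial (A := A).
Proof.
split=> /affine_trivialP tD; apply/affine_trivialP => E sE.
  apply/strongly_coaffine_pullback; rewrite (pullbackD hN hC).
  by apply: tD; apply/strongly_coaffine_pullback.
have [G EG] := pullback_surjective hN hC E.
apply: (strongly_coaffine_equiv hN' hC' (D := pullback D + pullback G)).
  rewrite opprD addrACA subrr add0r -opprB; exact: (principalN hN' hC').
rewrite -(pullbackD hN hC); apply/strongly_coaffine_pullback/tD/strongly_coaffine_pullback.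
exact: (strongly_coaffine_equiv hN' hC' EG).
Qed.

Lemma principal_affine_trivial (G : Div {poly A}) :
  principal G -> G \in affine_trivial (A := {poly A}).
Proof.
move=> pG; apply/affine_trivialP => E; apply: (strongly_coaffine_equiv hN' hC').
by rewrite opprD addrCA subrr addr0; exact: (principalN hN' hC').
Qed.

Definition class_pullback (x : affine_class_group A) : affine_class_group {poly A} :=
  affine_class (pullback (repr x)).

Lemma class_pullbackE D : class_pullback (affine_class D) = affine_class (pullback D).
Proof.
apply/affine_class_eq; rewrite -(pullbackB hN hC); apply/affine_trivial_pullback.
by apply/affine_class_eq; rewrite /affine_class reprK.
Qed.

Lemma class_pullback_zmod : zmod_morphism class_pullback.
Proof.
move=> x y; have [D ->] := affine_classW x; have [E ->] := affine_classW y.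
by rewrite -affine_classB !class_pullbackE (pullbackB hN hC) affine_classB.
Qed.

(** Surjectivity combines [pullback_surjective] with the affine triviality of principal divisors;
    injectivity is [affine_trivial_pullback]. *)
Lemma class_pullback_bij : bijective class_pullback.
Proof.
have /choice[g gE] : forall y, exists x, y = class_pullback x.
  move=> y; have [G ->] := affine_classW y.
  have [D GD] := pullback_surjective hN hC G; exists (affine_class D).
  by rewrite class_pullbackE; apply/affine_class_eq; exact: principal_affine_trivial.
have inj : injective class_pullback.
  move=> x y; have [D ->] := affine_classW x; have [E ->] := affine_classW y.
  rewrite !class_pullbackE => /affine_class_eq; rewrite -(pullbackB hN hC).
  by move/affine_trivial_pullback => ?; apply/affine_class_eq.
by exists g => x; [apply: inj|]; rewrite -gE.
Qed.

End Pullback.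

Theorem corollary2p5 (A : idomainType) (hN : noetherian A) (hA : normal_domain A) :
  exists f : {additive affine_class_group A -> affine_class_group {poly A}},
    bijective f /\ forall D : Div A, f (affine_class D) = affine_class (pullback D).
Proof.
have hC := normal_cic hN hA.
pose F : {additive affine_class_group A -> affine_class_group {poly A}} :=
  HB.pack (@class_pullback A)
    (GRing.isZmodMorphism.Build _ _ (@class_pullback A) (class_pullback_zmod hN hC)).
exists F; split; first exact: (class_pullback_bij hN hC).
exact: (class_pullbackE hN hC).
Qed.
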